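(* Fix integers $p\ge0$ and $K\ge0$. Consider the one-step method for the initial value problem that, on each subinterval $I_n$ ($n=0,\dots,N-1$), starting from $u_0$ given and the current value $u_n$, performs $K$ iterations of the explicit SDG scheme (from the explicit-Euler initial iterate) or of the implicit SDG scheme (from the implicit-Euler initial iterate), and sets $u_{n+1}=u^K_{n,p}$. Then the method is accurate of order $\min\{2p+1,K+1\}$, i.e. $\max_{0\le n\le N}|u(t_n)-u_n|=\mathcal{O}\left(h^{\min\{2p+1,K+1\}}\right)$ as $h\to0$.
   Context: Initial value problem: $u'(t)=f(t,u(t))$ for $t\in[0,T]$, $u(0)=u_0\in\mathbb{R}$, with $f:\mathbb{R}\times\mathbb{R}\to\mathbb{R}$ sufficiently smooth (of class $\mathcal{C}^{2p+1}$) and Lipschitz in $u$; $u$ denotes the exact solution. Partition $0=t_0<t_1<\dots<t_N=T$, $I_n=[t_n,t_{n+1}]$, $\Delta t_n=t_{n+1}-t_n$, $h=\max_n\Delta t_n$. On the reference interval $[-1,1]$ let $-1<\tau_0<\tau_1<\dots<\tau_p=1$ be the $p+1$ right Gauss–Radau points (including the right endpoint; the quadrature $\int_{-1}^1 g\approx\sum_j\omega_j g(\tau_j)$ with the corresponding weights $\omega_j$ is exact for polynomials of degree $\le 2p$), and $\ell_0,\dots,\ell_p$ the Lagrange polynomials of degree $p$ with $\ell_i(\tau_j)=\delta_{ij}$. Nodes on $I_n$: $t_{n,m}=t_n+\frac{(\tau_m+1)\Delta t_n}{2}$, so $t_{n,p}=t_{n+1}$. Define the $(p+1)\times(p+1)$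 matrix $L_{i,j}=\int_{-1}^1\ell_i'(\tau)\ell_j(\tau)\,d\tau-\delta_{ip}\delta_{jp}$ (invertible), with inverse $L^{-1}=(l^{-1}_{i,j})$. Define the matrix $\tilde L=(\tilde l_{i,j})_{0\le i,j\le p}$ by $\tilde l_{0,j}=-l^{-1}_{0,j}$ and $\tilde l_{m+1,j}=l^{-1}_{m,j}-l^{-1}_{m+1,j}$ for $0\le m\le p-1$. Write $f^k_{n,j}=f(t_{n,j},u^k_{n,j})$. Explicit SDG scheme: for $k\ge0$, $u^{k+1}_{n,0}=u_n+\frac{\Delta t_n}{2}\sum_{j=0}^p\tilde l_{0,j}\omega_j f^k_{n,j}$, and for $0\le m\le p-1$: $u^{k+1}_{n,m+1}=u^{k+1}_{n,m}+\frac{\Delta t_n}{2}\omega_m\big(f^{k+1}_{n,m}-f^k_{n,m}\big)+\frac{\Delta t_n}{2}\sum_{j=0}^p\tilde l_{m+1,j}\omega_j f^k_{n,j}$. Implicit SDG scheme: for $k\ge0$ (each step solves a scalar equation, uniquely solvable for $h$ small), $u^{k+1}_{n,0}=u_n+\frac{\Delta t_n}{2}\omega_0\big(f^{k+1}_{n,0}-f^k_{n,0}\big)+\frac{\Delta t_n}{2}\sum_{j=0}^p\tilde l_{0,j}\omega_j f^k_{n,j}$, and for $0\le m\le p-1$: $u^{k+1}_{n,m+1}=u^{k+1}_{n,m}+\frac{\Delta t_n}{2}\omega_{m+1}\big(f^{k+1}_{n,m+1}-f^k_{n,m+1}\big)+\frac{\Delta t_n}{2}\sum_{j=0}^p\tilde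 l_{m+1,j}\omega_j f^k_{n,j}$. The explicit-Euler initial iterate is $u^0_{n,0}=u_n+(t_{n,0}-t_n)f(t_n,u_n)$, $u^0_{n,m+1}=u^0_{n,m}+(t_{n,m+1}-t_{n,m})f(t_{n,m},u^0_{n,m})$; the implicit-Euler initial iterate is $u^0_{n,0}=u_n+(t_{n,0}-t_n)f(t_{n,0},u^0_{n,0})$, $u^0_{n,m+1}=u^0_{n,m}+(t_{n,m+1}-t_{n,m})f(t_{n,m+1},u^0_{n,m+1})$. All $\mathcal{O}(\cdot)$ constants are independent of $n$ and $h$. *)

(* Defs.v *)
From Stdlib Require Import Reals Lra Lia.
Open Scope R_scope.

Definition kdelta (i j : nat) : R := if Nat.eqb i j then 1 else 0.

Definition jcont (g : R -> R -> R) : Prop :=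
  forall t u eps, eps > 0 -> exists d, d > 0 /\
    forall t' u', Rabs (t' - t) < d -> Rabs (u' - u) < d ->
      Rabs (g t' u' - g t u) < eps.

Fixpoint Ck (k : nat) (g : R -> R -> R) : Prop :=
  match k with
  | O => jcont g
  | S k' => jcont g /\
      exists gt gu : R -> R -> R,
        (forall t u, derivable_pt_lim (fun s => g s u) t (gt t u)) /\
        (forall t u, derivable_pt_lim (fun v => g t v) u (gu t u)) /\
        Ck k' gt /\ Ck k' gu
  end.

Definition lipschitz_u (f : R -> R -> R) : Prop :=
  exists Lc, forall t x y, Rabs (f t x - f t y) <= Lc * Rabs (x - y).

(* tau_0 < ... < tau_p, omega_0..omega_p: the p+1 right Gauss-Radau points
   and weights on [-1,1]: -1 < tau_0, tau_p = 1, quadrature exact for all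
   polynomials of degree <= 2p (equivalently for the monomials x^k, k<=2p). *)
Definition right_radau (p : nat) (tau omega : nat -> R) : Prop :=
  -1 < tau 0%nat /\
  (forall m, (m < p)%nat -> tau m < tau (S m)) /\
  tau p = 1 /\
  forall k, (k <= 2 * p)%nat ->
    forall pr : Riemann_integrable (fun x => x ^ k) (-1) 1,
      RiemannInt pr = sum_f_R0 (fun j => omega j * tau j ^ k) p.

Fixpoint lag_aux (tau : nat -> R) (i : nat) (x : R) (n : nat) : R :=
  let fac := if Nat.eqb i n then 1 else (x - tau n) / (tau i - tau n) in
  match n with
  | O => fac
  | S n' => lag_aux tau i x n' * fac
  end.
Definition lag (p : nat) (tau : nat -> R) (i : nat) (x : R) : R :=
  lag_aux tau i x p.

Definition is_Lmat (p : nat) (tau : nat -> R) (Lm : nat -> nat -> R) : Prop :=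
  forall i j, (i <= p)%nat -> (j <= p)%nat ->
    forall (d : derivable (lag p tau i))
      (pr : Riemann_integrable
              (fun x => derive (lag p tau i) d x * lag p tau j x) (-1) 1),
      Lm i j = RiemannInt pr - kdelta i p * kdelta j p.

Definition is_inverse (p : nat) (Lm Li : nat -> nat -> R) : Prop :=
  forall i j, (i <= p)%nat -> (j <= p)%nat ->
    sum_f_R0 (fun k => Lm i k * Li k j) p = kdelta i j /\
    sum_f_R0 (fun k => Li i k * Lm k j) p = kdelta i j.

Definition Ltilde (Li : nat -> nat -> R) (i j : nat) : R :=
  match i with
  | O => - Li O j
  | S m => Li m j - Li (S m) j
  end.

Definition tnode (tau : nat -> R) (tn dt : R) (m : nat) : R :=
  tn + (tau m + 1) * dt / 2.

(* One step of the method on I_n = [tn, tn+dt] starting from un, producing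
   unext = u^K_{n,p}.  U k m stands for u^k_{n,m}.  [expl = true]: explicit
   SDG scheme with explicit-Euler initial iterate; [expl = false]: implicit
   SDG scheme with implicit-Euler initial iterate.  The implicit relations
   are the scalar equations solved at each step. *)
Definition sdg_step (expl : bool) (p K : nat) (f : R -> R -> R)
  (tau omega : nat -> R) (Li : nat -> nat -> R) (tn dt un unext : R) : Prop :=
  let tm := tnode tau tn dt in
  let Lt := Ltilde Li in
  exists U : nat -> nat -> R,
    let F := fun k j => f (tm j) (U k j) in
    let Sg := fun k i => sum_f_R0 (fun j => Lt i j * omega j * F k j) p in
    (if expl then
       U O O = un + (tm O - tn) * f tn un /\
       (forall m, (m < p)%nat ->
          U O (S m) = U O m + (tm (S m) - tm m) * f (tm m) (U O m))
     else
       U O O = un + (tm O - tn) * f (tm O) (U O O) /\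
       (forall m, (m < p)%nat ->
          U O (S m) = U O m + (tm (S m) - tm m) * f (tm (S m)) (U O (S m)))) /\
    (forall k, (k < K)%nat ->
      if expl then
        U (S k) O = un + dt / 2 * Sg k O /\
        (forall m, (m < p)%nat ->
           U (S k) (S m) = U (S k) m
             + dt / 2 * omega m * (F (S k) m - F k m)
             + dt / 2 * Sg k (S m))
      else
        U (S k) O = un + dt / 2 * omega O * (F (S k) O - F k O)
                       + dt / 2 * Sg k O /\
        (forall m, (m < p)%nat ->
           U (S k) (S m) = U (S k) m
             + dt / 2 * omega (S m) * (F (S k) (S m) - F k (S m))
             + dt / 2 * Sg k (S m))) /\
    unext = U K p.

Definition partition (T : R) (N : nat) (t : nat -> R) : Prop :=
  t O = 0 /\ t N = T /\ forall n, (n < N)%nat -> t n < t (S n).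

Fixpoint mesh (t : nat -> R) (N : nat) : R :=
  match N with
  | O => 0
  | S n => Rmax (mesh t n) (t (S n) - t n)
  end.

Definition sdg_solution (expl : bool) (p K : nat) (f : R -> R -> R)
  (tau omega : nat -> R) (Li : nat -> nat -> R) (u0 : R)
  (N : nat) (t : nat -> R) (un : nat -> R) : Prop :=
  un O = u0 /\
  forall n, (n < N)%nat ->
    sdg_step expl p K f tau omega Li (t n) (t (S n) - t n) (un n) (un (S n)).

Definition cont_on (u : R -> R) (a b : R) : Prop :=
  forall t, a <= t <= b -> forall eps, eps > 0 -> exists d, d > 0 /\
    forall s, a <= s <= b -> Rabs (s - t) < d -> Rabs (u s - u t) < eps.

(* Main.v *)
Require Import Defs.
From Stdlib Require Import Reals Factorial ClassicalEpsilon Lra Lia.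
From Coquelicot Require Import Coquelicot.
Open Scope R_scope.

(** Summing the sweeps over the nodes shows that [u^(k+1)] is a Picard iterate
    of the discontinuous Galerkin equations [U = u_n - dt/2 L^-1 W f(U)], up to
    [O(dt) |u^(k+1) - u^k|].  Hence the increments [u^(k+1) - u^k] gain one power
    of [dt] per sweep, and [u^K] solves these equations with a defect
    [O(dt^(K+2) + dt |E|)], where [E] is the error at [t_n].

    For an approximate solution [U] of these equations with defect [d], exactness
    of the Radau quadrature gives the stage error [O(|E| + d + dt^(p+2))].
    Superconvergence at the endpoint is a duality argument: [P^T L] is computable
    for the nodal values of a polynomial [P] of degree [p], and taking for [P] the
    Taylor polynomial of the solution of the adjoint equation [z' = - f_u(t, u) z]
    leaves products of two small factors and the quadrature error of [(P u)'],
    all [O(dt^(2p+2))].  Everything is compared with the exact solution [u]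
    directly, so neither the flow of the equation nor the solvability of the
    implicit equations is needed; a discrete Gronwall argument concludes. *)

(** * Finite sums *)

(** The Gronwall argument works only if one step turns the old error E into (1 + O(dt)) |E|; a
    factor C > 1 independent of dt would accumulate over the steps. This shapes every estimate.
    Euler iterates and increments are measured against the straight line from [un] with the exact
    slope [f tn (y tn)], so that E enters only through dt * (dt + |E|). For the same reason the test
    polynomial at the left end is compared with the dual solution at the right end before dividing
    by the latter.

    No a priori bound on E is at hand, while second derivatives of [f] are bounded only near the
    exact solution. Hence the nonlinear remainder gets two bounds: a linear one valid everywhere,
    from the global Lipschitz constant, and a quadratic one in a tube of radius 1. The larger of |E|
    + d and dt^(p+2) decides which one is used.

    The case p = 0 is separate: [f] is then only of class C^1, but p + 2 = 2 p + 2, so the stage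
    error is already of the required order.

    The exponent of the theorem is one less than the smaller of 2 p + 2 (quadrature) and K + 2
    (defect after K sweeps). *)

Lemma sum_scal_l n (F : nat -> R) c :
  sum_f_R0 (fun j => c * F j) n = c * sum_f_R0 F n.
Proof.
  rewrite scal_sum. apply sum_eq. intros; ring.
Qed.

Lemma sum_minus_distr n (F G : nat -> R) :
  sum_f_R0 (fun j => F j - G j) n = sum_f_R0 F n - sum_f_R0 G n.
Proof. induction n as [|n IH]; simpl; [|rewrite IH]; ring. Qed.

Lemma sum_swap m n (F : nat -> nat -> R) :
  sum_f_R0 (fun i => sum_f_R0 (fun j => F i j) n) m =
  sum_f_R0 (fun j => sum_f_R0 (fun i => F i j) m) n.
Proof.
  induction m as [|m IH]; simpl; [reflexivity|].
  now rewrite IH, <- sum_plus.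
Qed.

Lemma sum_zero n (F : nat -> R) :
  (forall j, (j <= n)%nat -> F j = 0) -> sum_f_R0 F n = 0.
Proof.
  intros H; induction n as [|n IH]; simpl; [now apply H|].
  rewrite IH, H; [ring|lia|intros; apply H; lia].
Qed.

Lemma kdelta_refl i : kdelta i i = 1.
Proof. unfold kdelta; now rewrite Nat.eqb_refl. Qed.

Lemma kdelta_neq i j : i <> j -> kdelta i j = 0.
Proof. intros H; unfold kdelta; now rewrite (proj2 (Nat.eqb_neq i j) H). Qed.

Lemma kdelta_sym i j : kdelta i j = kdelta j i.
Proof. unfold kdelta; now rewrite Nat.eqb_sym. Qed.

Lemma sum_kdelta n (F : nat -> R) i :
  (i <= n)%nat -> sum_f_R0 (fun j => kdelta i j * F j) n = F i.
Proof.
  induction n as [|n IH]; simpl; intros Hi.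
  - replace i with 0%nat by lia. rewrite kdelta_refl; ring.
  - destruct (Nat.eq_dec i (S n)) as [->|Hne].
    + rewrite kdelta_refl, sum_zero; [ring|].
      intros j Hj; rewrite kdelta_neq by lia; ring.
    + rewrite IH, kdelta_neq by lia; ring.
Qed.

Lemma sum_nonneg n (F : nat -> R) :
  (forall j, (j <= n)%nat -> 0 <= F j) -> 0 <= sum_f_R0 F n.
Proof.
  intros H. replace 0 with (sum_f_R0 (fun _ => 0) n) by (now apply sum_zero).
  now apply sum_Rle.
Qed.

Lemma sum_le_range m n (F : nat -> R) :
  (forall j, (j <= n)%nat -> 0 <= F j) -> (m <= n)%nat ->
  sum_f_R0 F m <= sum_f_R0 F n.
Proof.
  intros H Hmn; induction Hmn as [|n Hmn IH]; [lra|].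
  simpl. assert (0 <= F (S n)) by (apply H; lia).
  assert (sum_f_R0 F m <= sum_f_R0 F n) by (apply IH; intros; apply H; lia). lra.
Qed.

Lemma sum_term_le n (F : nat -> R) i :
  (forall j, (j <= n)%nat -> 0 <= F j) -> (i <= n)%nat -> F i <= sum_f_R0 F n.
Proof.
  intros H Hi. apply Rle_trans with (sum_f_R0 F i); [|now apply sum_le_range].
  destruct i as [|i]; simpl; [lra|].
  enough (0 <= sum_f_R0 F i) by lra.
  apply sum_nonneg; intros; apply H; lia.
Qed.

Lemma sum_const_le n (F : nat -> R) B :
  (forall j, (j <= n)%nat -> F j <= B) -> sum_f_R0 F n <= INR (S n) * B.
Proof.
  intros H. replace (INR (S n) * B) with (sum_f_R0 (fun _ => B) n).
  - now apply sum_Rle.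
  - rewrite sum_cte; ring.
Qed.

Lemma sum_abs_le n (F G : nat -> R) :
  (forall j, (j <= n)%nat -> Rabs (F j) <= G j) ->
  Rabs (sum_f_R0 F n) <= sum_f_R0 G n.
Proof.
  intros H. eapply Rle_trans; [apply Rsum_abs|]. now apply sum_Rle.
Qed.

Lemma sum_weighted_le n (w F : nat -> R) B :
  (forall j, (j <= n)%nat -> Rabs (F j) <= B) ->
  Rabs (sum_f_R0 (fun j => w j * F j) n) <= sum_f_R0 (fun j => Rabs (w j)) n * B.
Proof.
  intros H. rewrite Rmult_comm, <- sum_scal_l. apply sum_abs_le.
  intros j Hj. rewrite Rabs_mult, Rmult_comm.
  apply Rmult_le_compat_r; [apply Rabs_pos|now apply H].
Qed.

(** Summing the hypothesis over [m] bounds the whole sum by (n + 1) B plus half of itself. This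
    absorption handles the implicit coupling between the nodes without solving any equation. *)
Lemma sum_absorb n (x : nat -> R) B c :
  (forall m, (m <= n)%nat -> 0 <= x m) ->
  (forall m, (m <= n)%nat -> x m <= B + c * sum_f_R0 x n) ->
  INR (S n) * c <= 1 / 2 ->
  forall m, (m <= n)%nat -> x m <= 2 * INR (S n) * B.
Proof.
  intros H0 H Hc m Hm.
  assert (Hs := sum_const_le n x _ H).
  assert (H1 := sum_nonneg n x H0).
  assert (H2 := sum_term_le n x m H0 Hm). nra.
Qed.

Lemma pow_antitone x i j : 0 <= x <= 1 -> (i <= j)%nat -> x ^ j <= x ^ i.
Proof.
  intros Hx Hij. replace j with (i + (j - i))%nat by lia. rewrite pow_add.
  assert (0 <= x ^ i) by (apply pow_le; lra).
  assert (x ^ (j - i) <= 1) by (rewrite <- (pow1 (j - i)); apply pow_incr; lra).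
  nra.
Qed.

(** * Polynomial functions *)

(** Horner form with a degree bound, stated pointwise: inductions peel off the constant term, and no
    coefficient list has to be carried along. *)
Fixpoint polyd (d : nat) (F : R -> R) : Prop :=
  match d with
  | O => exists c, forall x, F x = c
  | S d' => exists c G, polyd d' G /\ forall x, F x = c + x * G x
  end.

Lemma polyd_ext d F G : (forall x, F x = G x) -> polyd d F -> polyd d G.
Proof.
  destruct d as [|d]; simpl.
  - intros H [c Hc]; exists c; intros; now rewrite <- H.
  - intros H (c & K & HK & Hc); exists c, K; split; [easy|]; intros; now rewrite <- H.
Qed.

Lemma polyd_const d c : polyd d (fun _ => c).
Proof.
  revert c; induction d as [|d IH]; simpl; intros c; [now exists c|].
  exists c, (fun _ => 0); split; [apply IH|]; intros; ring.
Qed.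

Lemma polyd_S d F : polyd d F -> polyd (S d) F.
Proof.
  revert F; induction d as [|d IH]; intros F.
  - intros [c Hc]. exists c, (fun _ => 0); split; [apply polyd_const|].
    intros; rewrite Hc; ring.
  - intros (c & G & HG & Hc). exists c, G; split; [now apply IH|easy].
Qed.

Lemma polyd_le d e F : (d <= e)%nat -> polyd d F -> polyd e F.
Proof. induction 1; auto using polyd_S. Qed.

Lemma polyd_plus d F G : polyd d F -> polyd d G -> polyd d (fun x => F x + G x).
Proof.
  revert F G; induction d as [|d IH]; simpl; intros F G.
  - intros [a Ha] [b Hb]; exists (a + b); intros; now rewrite Ha, Hb.
  - intros (a & F1 & HF & Ha) (b & G1 & HG & Hb).
    exists (a + b), (fun x => F1 x + G1 x); split; [now apply IH|].
    intros; rewrite Ha, Hb; ring.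
Qed.

Lemma polyd_scal d c F : polyd d F -> polyd d (fun x => c * F x).
Proof.
  revert F; induction d as [|d IH]; simpl; intros F.
  - intros [a Ha]; exists (c * a); intros; now rewrite Ha.
  - intros (a & F1 & HF & Ha).
    exists (c * a), (fun x => c * F1 x); split; [now apply IH|].
    intros; rewrite Ha; ring.
Qed.

Lemma polyd_mulx d F : polyd d F -> polyd (S d) (fun x => x * F x).
Proof. intros H; exists 0, F; split; [easy|]; intros; ring. Qed.

Lemma polyd_mult d e F G :
  polyd d F -> polyd e G -> polyd (d + e) (fun x => F x * G x).
Proof.
  revert F; induction d as [|d IH]; intros F.
  - intros [c Hc] HG. apply polyd_ext with (fun x => c * G x);
      [intros; now rewrite Hc|now apply polyd_scal].
  - intros (c & F1 & HF & Hc) HG.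
    apply polyd_ext with (fun x => c * G x + x * (F1 x * G x));
      [intros; rewrite Hc; ring|].
    apply polyd_plus; [|now apply polyd_mulx, IH].
    apply polyd_le with e; [lia|now apply polyd_scal].
Qed.

Lemma polyd_linear a b : polyd 1 (fun x => a * x + b).
Proof.
  exists b, (fun _ => a); split; [now exists a|]; intros; ring.
Qed.

Lemma polyd_affine d F a b : polyd d F -> polyd d (fun x => F (a * x + b)).
Proof.
  revert F; induction d as [|d IH]; intros F.
  - intros [c Hc]; exists c; intros; apply Hc.
  - intros (c & G & HG & Hc).
    apply polyd_ext with (fun x => c + (a * x + b) * G (a * x + b));
      [intros; now rewrite Hc|].
    apply polyd_plus; [apply polyd_const|].
    apply (polyd_mult 1 d); [apply polyd_linear|now apply IH].
Qed.

Lemma polyd_pow k a : polyd k (fun x => (x - a) ^ k).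
Proof.
  induction k as [|k IH]; simpl; [now exists 1|].
  apply (polyd_mult 1 k); [|exact IH].
  apply polyd_ext with (fun x => 1 * x + - a); [intros; ring|apply polyd_linear].
Qed.

Lemma polyd_sum d n (F : nat -> R -> R) :
  (forall k, (k <= n)%nat -> polyd d (F k)) ->
  polyd d (fun x => sum_f_R0 (fun k => F k x) n).
Proof.
  induction n as [|n IH]; simpl; intros H; [now apply H|].
  apply polyd_plus; [apply IH; intros; apply H; lia|apply H; lia].
Qed.

Lemma polyd_derive d F :
  polyd d F -> exists F', polyd (pred d) F' /\ forall x, is_derive F x (F' x).
Proof.
  revert F; induction d as [|d IH]; intros F.
  - intros [c Hc]; exists (fun _ => 0); split; [now exists 0|]; intros x.
    apply is_derive_ext with (fun _ => c); [intros; now rewrite Hc|].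
    apply (is_derive_const c x).
  - intros (c & G & HG & Hc). destruct (IH G HG) as (G' & HG' & HD).
    exists (fun x => G x + x * G' x); split.
    + simpl. destruct d as [|d].
      * destruct HG as [k Hk]. exists k; intros x.
        (* The bound to reach is degree 0, so the term x * G'(x) has to vanish identically; it does,
           since [G] is constant here. *)
        assert (G' x = 0) as ->.
        { rewrite <- (is_derive_unique _ _ _ (HD x)).
          rewrite (Derive_ext G (fun _ => k)) by easy. apply Derive_const. }
        rewrite Hk; ring.
      * apply polyd_plus; [easy|now apply polyd_mulx].
    + intros x. apply is_derive_ext with (fun x => c + x * G x); [intros; now rewrite Hc|].
      assert (HDx := HD x). auto_derive.
      * now exists (G' x).
      * replace (Derive _ x) with (G' x) by (symmetry; now apply is_derive_unique); ring.
Qed.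

Lemma polyd_continuous d F x : polyd d F -> continuous F x.
Proof.
  intros H; destruct (polyd_derive d F H) as (F' & _ & HD).
  apply (ex_derive_continuous F x). now exists (F' x).
Qed.

Lemma polyd_factor d F a :
  polyd (S d) F -> exists G, polyd d G /\ forall x, F x = F a + (x - a) * G x.
Proof.
  revert F; induction d as [|d IH]; intros F (c & G & HG & Hc).
  - destruct HG as [k Hk]. exists (fun _ => k); split; [now exists k|].
    intros; rewrite !Hc, !Hk; ring.
  - destruct (IH G HG) as (H & HH & HGa).
    exists (fun x => G a + x * H x); split.
    + exists (G a), H; split; [easy|reflexivity].
    + intros; rewrite !Hc, (HGa x); ring.
Qed.

(** Roots are split off one at a time as linear factors. This is what identifies a polynomial of
    degree p with its Lagrange interpolant at the nodes. *)
Lemma polyd_zero d F (pts : nat -> R) :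
  polyd d F ->
  (forall i j, (i < j)%nat -> (j <= d)%nat -> pts i <> pts j) ->
  (forall j, (j <= d)%nat -> F (pts j) = 0) -> forall x, F x = 0.
Proof.
  revert F; induction d as [|d IH]; intros F HF Hinj Hz x.
  - destruct HF as [c Hc]. now rewrite Hc, <- (Hc (pts 0%nat)), Hz.
  - destruct (polyd_factor d F (pts (S d)) HF) as (G & HG & HFG).
    rewrite HFG, (Hz (S d)), (IH G); [ring|easy| | |lia].
    + intros; apply Hinj; lia.
    + intros j Hj. assert (HFj := HFG (pts j)).
      rewrite !Hz in HFj by lia.
      assert (pts j <> pts (S d)) by (apply Hinj; lia).
      apply Rmult_eq_reg_l with (pts j - pts (S d)); lra.
Qed.

(** * Radau quadrature and the matrix [L] *)

Lemma radau_tau_lt p tau omega i j :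
  right_radau p tau omega -> (i < j)%nat -> (j <= p)%nat -> tau i < tau j.
Proof.
  intros (_ & Hinc & _) Hij; induction Hij as [|j Hij IH]; intros Hj.
  - apply Hinc; lia.
  - apply Rlt_trans with (tau j); [apply IH|apply Hinc]; lia.
Qed.

Lemma radau_tau_range p tau omega j :
  right_radau p tau omega -> (j <= p)%nat -> -1 < tau j <= 1.
Proof.
  intros HR Hj. assert (H0 : -1 < tau 0%nat) by apply HR.
  assert (Hp : tau p = 1) by apply HR. split.
  - destruct j as [|j]; [easy|].
    assert (tau 0%nat < tau (S j)) by (apply (radau_tau_lt p tau omega); [easy|lia|easy]). lra.
  - destruct (Nat.eq_dec j p) as [->|]; [lra|].
    assert (tau j < tau p) by (apply (radau_tau_lt p tau omega); [easy|lia|lia]). lra.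
Qed.

(** The factor of index [i] is replaced by 1, so the degree drops from n + 1 to n exactly when [i]
    is among the indices already multiplied in. The induction has to carry both cases. *)
Lemma lag_aux_polyd tau i n :
  polyd (if Nat.leb i n then n else S n) (fun x => lag_aux tau i x n).
Proof.
  assert (Hfac : forall m, polyd 1 (fun x => (x - tau m) / (tau i - tau m))).
  { intros m. apply polyd_ext with
      (fun x => / (tau i - tau m) * x + - tau m / (tau i - tau m)).
    - intros; unfold Rdiv; ring.
    - apply polyd_linear. }
  induction n as [|n IH].
  - simpl. destruct i as [|i]; simpl; [now exists 1|apply Hfac].
  - simpl lag_aux. destruct (Nat.eqb_spec i (S n)) as [->|Hne].
    + rewrite Nat.leb_refl. rewrite (proj2 (Nat.leb_gt (S n) n)) in IH by lia.
      apply polyd_ext with (fun x => lag_aux tau (S n) x n); [intros; ring|easy].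
    + destruct (Nat.leb_spec i n).
      * rewrite (proj2 (Nat.leb_le i (S n))) by lia.
        replace (S n) with (n + 1)%nat by lia. now apply polyd_mult.
      * rewrite (proj2 (Nat.leb_gt i (S n))) by lia.
        replace (S (S n)) with (S n + 1)%nat by lia. now apply polyd_mult.
Qed.

Lemma lag_polyd p tau i : (i <= p)%nat -> polyd p (lag p tau i).
Proof.
  intros Hi. assert (H := lag_aux_polyd tau i p).
  now rewrite (proj2 (Nat.leb_le i p) Hi) in H.
Qed.

Lemma lag_aux_zero tau i j n :
  (j <= n)%nat -> i <> j -> lag_aux tau i (tau j) n = 0.
Proof.
  intros Hj Hij; induction n as [|n IH]; simpl.
  - replace j with 0%nat in * by lia. rewrite (proj2 (Nat.eqb_neq i 0)) by lia.
    unfold Rdiv; ring.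
  - destruct (Nat.eq_dec j (S n)) as [->|].
    + rewrite (proj2 (Nat.eqb_neq i (S n))) by lia. unfold Rdiv; ring.
    + rewrite IH by lia. ring.
Qed.

Lemma lag_aux_one tau i n :
  (forall j, (j <= n)%nat -> i <> j -> tau i <> tau j) ->
  lag_aux tau i (tau i) n = 1.
Proof.
  intros H; induction n as [|n IH]; simpl.
  - destruct (Nat.eqb_spec i 0); [easy|].
    assert (tau i <> tau 0%nat) by (apply H; lia). field; lra.
  - rewrite IH by (intros; apply H; lia).
    destruct (Nat.eqb_spec i (S n)); [ring|].
    assert (tau i <> tau (S n)) by (apply H; lia). field; lra.
Qed.

Lemma lag_node p tau omega i j :
  right_radau p tau omega -> (i <= p)%nat -> (j <= p)%nat ->
  lag p tau i (tau j) = kdelta i j.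
Proof.
  intros HR Hi Hj. unfold lag. destruct (Nat.eq_dec i j) as [<-|Hne].
  - rewrite kdelta_refl. apply lag_aux_one. intros k Hk Hne.
    destruct (Nat.lt_ge_cases i k).
    + assert (tau i < tau k) by (apply (radau_tau_lt p tau omega); auto). lra.
    + assert (tau k < tau i) by (apply (radau_tau_lt p tau omega); auto; lia). lra.
  - rewrite kdelta_neq by easy. now apply lag_aux_zero.
Qed.

Lemma radau_RInt p tau omega d F :
  right_radau p tau omega -> polyd d F -> (d <= 2 * p)%nat ->
  is_RInt F (-1) 1 (sum_f_R0 (fun j => omega j * F (tau j)) p).
Proof.
  intros (_ & _ & _ & Hq) HF Hd.
  assert (Hmono : forall k, (k <= 2 * p)%nat ->
    is_RInt (fun x => x ^ k) (-1) 1 (sum_f_R0 (fun j => omega j * tau j ^ k) p)).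
  { intros k Hk.
    assert (Hex : ex_RInt (fun x => x ^ k) (-1) 1).
    { apply (ex_RInt_continuous (V := R_CompleteNormedModule)). intros x _.
      apply (polyd_continuous k).
      apply polyd_ext with (fun x => (x - 0) ^ k);
        [intros; now rewrite Rminus_0_r|apply polyd_pow]. }
    rewrite <- (Hq k Hk (ex_RInt_Reals_0 _ _ _ Hex)), <- RInt_Reals.
    now apply (RInt_correct (V := R_CompleteNormedModule)). }
  (* The extra factor x^i makes the Horner recursion an induction: peeling off a constant term
     raises [i] by one and lowers [d] by one. *)
  assert (Hgen : forall d F i, polyd d F -> (d + i <= 2 * p)%nat ->
    is_RInt (fun x => x ^ i * F x) (-1) 1
      (sum_f_R0 (fun j => omega j * (tau j ^ i * F (tau j))) p)).
  { clear d F HF Hd. induction d as [|d IH]; intros F i HF Hd.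
    - destruct HF as [c Hc].
      apply is_RInt_ext with (fun x => scal c (x ^ i)).
      { intros; rewrite Hc. unfold scal; simpl; unfold mult; simpl; ring. }
      rewrite (sum_eq _ (fun j => c * (omega j * tau j ^ i)))
        by (intros; rewrite Hc; ring).
      rewrite sum_scal_l. apply (is_RInt_scal (V := R_NormedModule)), Hmono; lia.
    - destruct HF as (c & G & HG & Hc).
      apply is_RInt_ext with (fun x => plus (scal c (x ^ i)) (x ^ (S i) * G x)).
      { intros; rewrite Hc. unfold scal, plus; simpl; unfold mult; simpl; ring. }
      rewrite (sum_eq _ (fun j => c * (omega j * tau j ^ i)
                          + omega j * (tau j ^ (S i) * G (tau j))))
        by (intros; rewrite Hc; simpl; ring).
      rewrite sum_plus, sum_scal_l.
      apply (is_RInt_plus (V := R_NormedModule)).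
      + apply (is_RInt_scal (V := R_NormedModule)), Hmono; lia.
      + apply IH; [easy|lia]. }
  apply is_RInt_ext with (fun x => x ^ 0 * F x); [intros; simpl; ring|].
  rewrite (sum_eq _ (fun j => omega j * (tau j ^ 0 * F (tau j))))
    by (intros; simpl; ring).
  apply (Hgen d); [easy|lia].
Qed.

(** Differentiation lowers the degree by one, so exactness up to degree 2 p reaches products of
    degree 2 p + 1. Applied to products, this is a discrete integration by parts. *)
Lemma radau_derive p tau omega d H H' :
  right_radau p tau omega -> polyd d H -> (d <= 2 * p + 1)%nat ->
  (forall x, is_derive H x (H' x)) ->
  sum_f_R0 (fun j => omega j * H' (tau j)) p = H 1 - H (-1).
Proof.
  intros HR HH Hd HD. destruct (polyd_derive d H HH) as (F & HF & HDF).
  assert (Heq : forall x, H' x = F x).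
  { intros x. rewrite <- (is_derive_unique _ _ _ (HD x)).
    now apply is_derive_unique. }
  rewrite (sum_eq _ (fun j => omega j * F (tau j))) by (intros; now rewrite Heq).
  assert (HI := radau_RInt p tau omega (pred d) F HR HF ltac:(lia)).
  assert (HI' : is_RInt F (-1) 1 (minus (H 1) (H (-1)))).
  { apply (is_RInt_derive (V := R_CompleteNormedModule)); intros x _; [apply HDF|].
    now apply (polyd_continuous (pred d)). }
  apply (is_RInt_unique (V := R_CompleteNormedModule)) in HI.
  apply (is_RInt_unique (V := R_CompleteNormedModule)) in HI'.
  rewrite <- HI. exact HI'.
Qed.

(** The integrand has degree at most 2 p, so the quadrature evaluates it exactly, and the second
    Lagrange factor keeps only node [j]. As [is_Lmat] speaks of arbitrary derivability and
    integrability proofs, one of each is built to instantiate it. *)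
Lemma Lmat_entry p tau omega Lm i j D :
  right_radau p tau omega -> is_Lmat p tau Lm ->
  (i <= p)%nat -> (j <= p)%nat ->
  (forall x, is_derive (lag p tau i) x (D x)) ->
  Lm i j = omega j * D (tau j) - kdelta i p * kdelta j p.
Proof.
  intros HR HL Hi Hj HD.
  assert (HDr : forall x, derivable_pt_lim (lag p tau i) x (D x))
    by (intros; now apply is_derive_Reals).
  set (d := (fun x => exist _ (D x) (HDr x)) : derivable (lag p tau i)).
  destruct (polyd_derive p _ (lag_polyd p tau i Hi)) as (F & HF & HDF).
  assert (Heq : forall x, D x = F x).
  { intros x. rewrite <- (is_derive_unique _ _ _ (HD x)).
    now apply is_derive_unique. }
  assert (HP : polyd (pred p + p) (fun x => derive (lag p tau i) d x * lag p tau j x)).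
  { apply polyd_ext with (fun x => F x * lag p tau j x).
    - intros x. f_equal. rewrite <- Heq. symmetry.
      unfold derive. now apply derive_pt_eq.
    - apply polyd_mult; [easy|now apply lag_polyd]. }
  assert (HI := radau_RInt p tau omega _ _ HR HP ltac:(lia)).
  assert (Hex : ex_RInt (fun x => derive (lag p tau i) d x * lag p tau j x) (-1) 1)
    by (now exists (sum_f_R0 (fun k => omega k *
          (derive (lag p tau i) d (tau k) * lag p tau j (tau k))) p)).
  rewrite (HL i j Hi Hj d (ex_RInt_Reals_0 _ _ _ Hex)), <- RInt_Reals.
  rewrite (is_RInt_unique (V := R_CompleteNormedModule) _ _ _ _ HI). f_equal.
  rewrite (sum_eq _ (fun k => kdelta j k * (omega k * D (tau k)))).
  - now rewrite sum_kdelta.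
  - intros k Hk. rewrite (lag_node p tau omega j k HR Hj Hk).
    replace (derive (lag p tau i) d (tau k)) with (D (tau k)); [ring|].
    symmetry. unfold derive. now apply derive_pt_eq.
Qed.

(** [P] is its own interpolant, so contracting the first index of [L] with its nodal values turns
    the Lagrange derivatives into the derivative of [P]. *)
Lemma radau_test_identity p tau omega Lm P P' j :
  right_radau p tau omega -> is_Lmat p tau Lm ->
  polyd p P -> (forall x, is_derive P x (P' x)) -> (j <= p)%nat ->
  sum_f_R0 (fun i => P (tau i) * Lm i j) p
  = omega j * P' (tau j) - P 1 * kdelta j p.
Proof.
  intros HR HL HP HD Hj.
  assert (Hinterp : forall x, P x = sum_f_R0 (fun i => P (tau i) * lag p tau i x) p).
  { intros x. apply Rminus_diag_uniq.
    apply (polyd_zero p (fun x => P x - sum_f_R0 (fun i => P (tau i) * lag p tau i x) p) tau).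
    - apply polyd_ext with
        (fun x => P x + -1 * sum_f_R0 (fun i => P (tau i) * lag p tau i x) p);
        [intros; ring|].
      apply polyd_plus; [easy|]. apply polyd_scal, polyd_sum.
      intros k Hk. apply polyd_scal. now apply lag_polyd.
    - intros i k Hik Hk. assert (tau i < tau k) by (now apply (radau_tau_lt p tau omega)). lra.
    - intros k Hk.
      rewrite (sum_eq _ (fun i => kdelta k i * P (tau i))).
      + rewrite sum_kdelta by easy. ring.
      + intros i Hi. rewrite (lag_node p tau omega i k), kdelta_sym by easy. ring. }
  assert (HDl : exists D : nat -> R -> R, forall i, (i <= p)%nat ->
            forall x, is_derive (lag p tau i) x (D i x)).
  { exists (fun i => Derive (lag p tau i)). intros i Hi x.
    destruct (polyd_derive p _ (lag_polyd p tau i Hi)) as (F & _ & HF).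
    apply Derive_correct. now exists (F x). }
  destruct HDl as [D HDl].
  assert (HP' : forall x, P' x = sum_f_R0 (fun i => P (tau i) * D i x) p).
  { intros x. rewrite <- (is_derive_unique _ _ _ (HD x)).
    apply is_derive_unique.
    apply is_derive_ext with (fun x => sum_n (fun i => P (tau i) * lag p tau i x) p).
    { intros y; rewrite sum_n_Reals; symmetry; apply Hinterp. }
    rewrite <- sum_n_Reals. apply (is_derive_sum_n (fun i x => P (tau i) * lag p tau i x)).
    intros i Hi. apply is_derive_scal. now apply HDl. }
  rewrite (sum_eq _ (fun i => omega j * (P (tau i) * D i (tau j))
             - kdelta j p * (kdelta p i * P (tau i)))).
  - rewrite sum_minus_distr, !sum_scal_l, sum_kdelta, <- HP' by easy.
    replace (tau p) with 1 by (symmetry; apply HR). ring.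
  - intros i Hi.
    rewrite (Lmat_entry p tau omega Lm i j (D i) HR HL Hi Hj (HDl i Hi)).
    rewrite (kdelta_sym p i). ring.
Qed.

(** The equations reproduce polynomials of degree p + 1. Quadrature of the derivative of lag_i * (Y
    - Y(-1)), of degree 2 p + 1, is exact; the boundary term at -1 vanishes and the one at 1 is the
    Kronecker term of [L]. Hence L (Y - Y(-1)) = - omega Y' at the nodes, and applying the inverse
    gives the claim. *)
Lemma radau_stage_exact p tau omega Lm Li Y Y' m :
  right_radau p tau omega -> is_Lmat p tau Lm -> is_inverse p Lm Li ->
  polyd (S p) Y -> (forall x, is_derive Y x (Y' x)) -> (m <= p)%nat ->
  sum_f_R0 (fun j => Li m j * omega j * Y' (tau j)) p = Y (-1) - Y (tau m).
Proof.
  intros HR HL HI HY HD Hm.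
  assert (Hrow : forall i, (i <= p)%nat ->
    sum_f_R0 (fun l => Lm i l * (Y (tau l) - Y (-1))) p = - (omega i * Y' (tau i))).
  { intros i Hi.
    destruct (polyd_derive p _ (lag_polyd p tau i Hi)) as (D & _ & HDl).
    assert (Hq := radau_derive p tau omega (p + S p)
      (fun x => lag p tau i x * (Y x - Y (-1)))
      (fun x => D x * (Y x - Y (-1)) + lag p tau i x * Y' x) HR).
    cbv beta in Hq. replace (lag p tau i 1) with (kdelta i p) in Hq.
    2: { replace 1 with (tau p) by apply HR. symmetry. now apply (lag_node p tau omega). }
    rewrite (sum_eq _ (fun l => omega l * (D (tau l) * (Y (tau l) - Y (-1)))
               + kdelta i l * (omega l * Y' (tau l)))) in Hq.
    2: { intros l Hl. rewrite (lag_node p tau omega i l) by easy. ring. }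
    rewrite sum_plus, sum_kdelta in Hq by easy.
    rewrite (sum_eq _ (fun l => omega l * (D (tau l) * (Y (tau l) - Y (-1)))
               - kdelta i p * (kdelta p l * (Y (tau l) - Y (-1))))).
    2: { intros l Hl. rewrite (Lmat_entry p tau omega Lm i l D HR HL Hi Hl HDl).
         rewrite (kdelta_sym p l). ring. }
    rewrite sum_minus_distr, sum_scal_l, sum_kdelta by easy.
    replace (tau p) with 1 by (symmetry; apply HR).
    enough (HH : sum_f_R0 (fun l => omega l * (D (tau l) * (Y (tau l) - Y (-1)))) p
       + omega i * Y' (tau i) = kdelta i p * (Y 1 - Y (-1))) by lra.
    rewrite Hq; [ring| |lia|].
    - apply polyd_mult; [now apply lag_polyd|].
      apply polyd_ext with (fun x => Y x + - Y (-1)); [intros; ring|].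
      apply polyd_plus; [easy|apply polyd_const].
    - intros x. evar_last.
      + apply (is_derive_mult (lag p tau i) (fun x => Y x - Y (-1)) x).
        * apply HDl.
        * apply (is_derive_minus Y (fun _ => Y (-1)) x); [apply HD|apply is_derive_const].
        * intros; apply Rmult_comm.
      + unfold plus, mult, minus, opp, zero, plus; simpl. ring. }
  rewrite (sum_eq _ (fun j => - sum_f_R0 (fun l => Li m j * Lm j l * (Y (tau l) - Y (-1))) p)).
  2: { intros j Hj.
       rewrite (sum_eq _ (fun l => Li m j * (Lm j l * (Y (tau l) - Y (-1))))) by (intros; ring).
       rewrite sum_scal_l, (Hrow j Hj). ring. }
  rewrite (sum_eq _ (fun j => -1 * sum_f_R0 (fun l => Li m j * Lm j l * (Y (tau l) - Y (-1))) p))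
    by (intros; ring).
  rewrite sum_scal_l, sum_swap.
  rewrite (sum_eq _ (fun l => kdelta m l * (Y (tau l) - Y (-1)))).
  - rewrite sum_kdelta by easy. ring.
  - intros l Hl. rewrite <- (proj2 (HI m l Hm Hl)).
    rewrite Rmult_comm, <- sum_scal_l. apply sum_eq. intros; ring.
Qed.

(** * Smooth functions on an interval and Taylor expansion *)

(** Continuity is asked on the whole line, the derivative relation only inside the open interval:
    this is all that the exact solution offers, and the mean value theorem needs no derivative at
    the end points. *)
Fixpoint smooth (T : R) (k : nat) (F : R -> R) : Prop :=
  (forall x, continuous F x) /\
  match k with
  | O => True
  | S k' => exists F', (forall x, 0 < x < T -> is_derive F x (F' x)) /\ smooth T k' F'
  end.

Lemma smooth_continuous T k F x : smooth T k F -> continuous F x.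
Proof. destruct k; intros [H _]; apply H. Qed.

Lemma smooth_pred T k F : smooth T (S k) F -> smooth T k F.
Proof.
  revert F; induction k as [|k IH]; intros F (Hc & F' & HD & HF'); simpl; [easy|].
  split; [easy|]. exists F'; split; [easy|now apply IH].
Qed.

Lemma smooth_plus T k F G :
  smooth T k F -> smooth T k G -> smooth T k (fun x => F x + G x).
Proof.
  revert F G; induction k as [|k IH]; intros F G HF HG.
  - split; [|easy]. intros x. apply (continuous_plus F G x); [apply HF|apply HG].
  - destruct HF as (HcF & F' & HDF & HF'), HG as (HcG & G' & HDG & HG').
    split; [intros x; now apply (continuous_plus F G x)|].
    exists (fun x => F' x + G' x); split; [|now apply IH].
    intros x Hx. apply (is_derive_plus F G x); auto.
Qed.

Lemma smooth_mult T k F G :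
  smooth T k F -> smooth T k G -> smooth T k (fun x => F x * G x).
Proof.
  revert F G; induction k as [|k IH]; intros F G HF HG.
  - split; [|easy]. intros x. apply (continuous_mult F G x); [apply HF|apply HG].
  - assert (HF0 := smooth_pred _ _ _ HF). assert (HG0 := smooth_pred _ _ _ HG).
    destruct HF as (HcF & F' & HDF & HF'), HG as (HcG & G' & HDG & HG').
    split; [intros x; now apply (continuous_mult F G x)|].
    exists (fun x => F' x * G x + F x * G' x); split.
    + intros x Hx. apply (is_derive_mult F G x); auto. intros; apply Rmult_comm.
    + apply smooth_plus; now apply IH.
Qed.

Lemma smooth_opp T k F : smooth T k F -> smooth T k (fun x => - F x).
Proof.
  revert F; induction k as [|k IH]; intros F HF.
  - split; [|easy]. intros x. apply (continuous_opp F x), HF.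
  - destruct HF as (HcF & F' & HDF & HF').
    split; [intros x; now apply (continuous_opp F x)|].
    exists (fun x => - F' x); split; [|now apply IH].
    intros x Hx. apply (is_derive_opp F x); auto.
Qed.

(** The successive derivatives hidden in [smooth], chosen once and for all as a family, so that
    Taylor polynomials can be written down. *)
Definition jet (T : R) (k : nat) (w : nat -> R -> R) : Prop :=
  (forall i, (i <= k)%nat -> forall x, continuous (w i) x) /\
  (forall i, (i < k)%nat -> forall x, 0 < x < T -> is_derive (w i) x (w (S i) x)).

Lemma smooth_jet T k F : smooth T k F -> exists w, w 0%nat = F /\ jet T k w.
Proof.
  revert F; induction k as [|k IH]; intros F HF.
  - exists (fun _ => F); split; [easy|]. split; [intros; apply HF|intros; lia].
  - destruct HF as (Hc & F' & HD & HF'). destruct (IH F' HF') as (w & Hw0 & Hwc & Hwd).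
    exists (fun i => match i with O => F | S i' => w i' end). split; [easy|]. split.
    + intros [|i] Hi; [easy|apply Hwc; lia].
    + intros [|i] Hi; [rewrite Hw0; easy|apply Hwd; lia].
Qed.

Lemma jet_le T k l w : (k <= l)%nat -> jet T l w -> jet T k w.
Proof. intros Hkl [Hc Hd]; split; intros; [apply Hc|apply Hd]; auto; lia. Qed.

Lemma jet_shift T k w : jet T (S k) w -> jet T k (fun i => w (S i)).
Proof. intros [Hc Hd]; split; intros; [apply Hc|apply Hd]; auto; lia. Qed.

Lemma continuous_bounded a b F :
  (forall x, continuous F x) -> exists M, 0 <= M /\ forall x, a <= x <= b -> Rabs (F x) <= M.
Proof.
  intros Hc. destruct (Rle_dec a b) as [Hab|Hab].
  - assert (Hc' : forall x, a <= x <= b -> continuity_pt (fun x => Rabs (F x)) x).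
    { intros x _. apply continuity_pt_filterlim.
      apply (continuous_comp F Rabs x); [apply Hc|apply continuous_Rabs]. }
    destruct (continuity_ab_maj _ a b Hab Hc') as (x0 & Hx0 & _).
    exists (Rabs (F x0)); split; [apply Rabs_pos|exact Hx0].
  - exists 0; split; [lra|]. intros; lra.
Qed.

Lemma jet_bounded T k w :
  jet T k w -> exists M, 0 <= M /\
    forall i, (i <= k)%nat -> forall x, 0 <= x <= T -> Rabs (w i x) <= M.
Proof.
  induction k as [|k IH]; intros Hw.
  - destruct (continuous_bounded 0 T (w 0%nat)) as (M & HM & Hb).
    { intros; now apply Hw. }
    exists M; split; [easy|]. intros i Hi. now replace i with 0%nat by lia.
  - destruct (IH (jet_le T k (S k) w ltac:(lia) Hw)) as (M & HM & Hb).
    destruct (continuous_bounded 0 T (w (S k))) as (M' & HM' & Hb').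
    { intros; now apply Hw. }
    exists (Rmax M M'); split; [apply Rle_trans with M; [easy|apply Rmax_l]|].
    intros i Hi x Hx. destruct (Nat.eq_dec i (S k)) as [->|].
    + eapply Rle_trans; [now apply Hb'|apply Rmax_r].
    + eapply Rle_trans; [apply Hb; [lia|easy]|apply Rmax_l].
Qed.

Definition tay (w : nat -> R -> R) (a : R) (d : nat) (x : R) : R :=
  sum_f_R0 (fun k => w k a / INR (fact k) * (x - a) ^ k) d.

Definition dtay (w : nat -> R -> R) (a : R) (d : nat) (x : R) : R :=
  sum_f_R0 (fun k => w k a / INR (fact k) * (INR k * (x - a) ^ pred k)) d.

Lemma is_derive_tay w a d x : is_derive (tay w a d) x (dtay w a d x).
Proof.
  unfold tay, dtay. rewrite <- sum_n_Reals.
  apply is_derive_ext with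
    (fun x => sum_n (fun k => w k a / INR (fact k) * (x - a) ^ k) d).
  { intros y; apply sum_n_Reals. }
  apply (is_derive_sum_n (fun k x => w k a / INR (fact k) * (x - a) ^ k)).
  intros k _. auto_derive; [easy|]. unfold Rminus; ring.
Qed.

Lemma dtay_shift w a d x : dtay w a (S d) x = tay (fun i => w (S i)) a d x.
Proof.
  unfold dtay, tay. rewrite decomp_sum by lia. simpl pred.
  replace (INR 0) with 0 by reflexivity.
  rewrite Rmult_0_l, Rmult_0_r, Rplus_0_l.
  apply sum_eq. intros k _. simpl pred. rewrite fact_simpl, mult_INR.
  field. split; [apply INR_fact_neq_0|]. apply not_0_INR; lia.
Qed.

Lemma tay_center w a d : tay w a d a = w 0%nat a.
Proof.
  unfold tay. replace (a - a) with 0 by ring.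
  destruct d as [|d]; [simpl; field|].
  rewrite decomp_sum by lia. rewrite sum_zero; [simpl; field|].
  intros j Hj. simpl. ring.
Qed.

Lemma tay_polyd w a d : polyd d (tay w a d).
Proof.
  apply polyd_sum. intros k Hk. apply polyd_scal.
  apply polyd_le with k; [easy|apply polyd_pow].
Qed.

Lemma mean_value_bound T F F' M a x :
  (forall y, continuous F y) ->
  (forall y, 0 < y < T -> is_derive F y (F' y)) ->
  0 <= a <= T -> 0 <= x <= T ->
  (forall y, Rmin a x <= y <= Rmax a x -> Rabs (F' y) <= M) ->
  Rabs (F x - F a) <= M * Rabs (x - a).
Proof.
  intros Hc HD Ha Hx HM.
  assert (Hm : 0 <= Rmin a x) by (apply Rmin_glb; lra).
  assert (HM' : Rmax a x <= T) by (apply Rmax_lub; lra).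
  destruct (MVT_gen F a x F') as (c & Hcc & Heq).
  - intros y Hy. apply HD. lra.
  - intros y _. apply continuity_pt_filterlim. apply Hc.
  - rewrite Heq, Rabs_mult. apply Rmult_le_compat_r; [apply Rabs_pos|now apply HM].
Qed.

(** The derivative of the remainder is the remainder of the shifted jet, one degree lower, so the
    mean value inequality closes the induction; the factorial is given away. [x] may lie on either
    side of [a], which permits expansion about the right end of a step. *)
Lemma taylor_bound T d w M a x :
  jet T (S d) w -> (forall y, 0 <= y <= T -> Rabs (w (S d) y) <= M) ->
  0 <= a <= T -> 0 <= x <= T ->
  Rabs (w 0%nat x - tay w a d x) <= M * Rabs (x - a) ^ S d.
Proof.
  revert w x; induction d as [|d IH]; intros w x Hw HM Ha Hx.
  - unfold tay; simpl. rewrite !Rmult_1_r, Rdiv_1_r.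
    apply (mean_value_bound T (w 0%nat) (w 1%nat)); try easy.
    + intros y; apply Hw; lia.
    + intros y Hy; apply Hw; [lia|easy].
    + intros y Hy. apply HM. split; [apply Rle_trans with (Rmin a x)|apply Rle_trans with (Rmax a x)];
        try lra; [apply Rmin_glb; lra|apply Rmax_lub; lra].
  - replace (w 0%nat x - tay w a (S d) x) with
      ((w 0%nat x - tay w a (S d) x) - (w 0%nat a - tay w a (S d) a))
      by (rewrite (tay_center w a (S d)); ring).
    replace (M * Rabs (x - a) ^ S (S d)) with (M * Rabs (x - a) ^ S d * Rabs (x - a))
      by (simpl; ring).
    apply (mean_value_bound T (fun x => w 0%nat x - tay w a (S d) x)
             (fun x => w 1%nat x - dtay w a (S d) x)); try easy.
    + intros y. apply (continuous_minus (w 0%nat) (tay w a (S d)) y).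
      * apply Hw; lia.
      * apply (polyd_continuous (S d)), tay_polyd.
    + intros y Hy. apply (is_derive_minus (w 0%nat) (tay w a (S d)) y).
      * apply Hw; [lia|easy].
      * apply is_derive_tay.
    + intros y Hy. rewrite dtay_shift.
      assert (Hy' : 0 <= y <= T).
      { split; [apply Rle_trans with (Rmin a x)|apply Rle_trans with (Rmax a x)];
        try lra; [apply Rmin_glb; lra|apply Rmax_lub; lra]. }
      eapply Rle_trans; [apply (IH (fun i => w (S i)))|]; auto using jet_shift.
      apply Rmult_le_compat_l; [apply Rle_trans with (Rabs (w (S (S d)) a)); [apply Rabs_pos|auto]|].
      apply pow_incr. split; [apply Rabs_pos|].
      revert Hy. unfold Rmin, Rmax, Rabs. destruct (Rle_dec a x);
        destruct (Rcase_abs (y - a)); destruct (Rcase_abs (x - a)); lra.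
Qed.

Lemma taylor_derive_bound T d w M a x :
  jet T (S d) w -> (forall y, 0 <= y <= T -> Rabs (w (S d) y) <= M) ->
  0 <= a <= T -> 0 <= x <= T ->
  Rabs (w 1%nat x - dtay w a d x) <= M * Rabs (x - a) ^ d.
Proof.
  intros Hw HM Ha Hx. destruct d as [|d].
  - unfold dtay; simpl. rewrite Rmult_0_l, Rmult_0_r, Rminus_0_r, Rmult_1_r. now apply HM.
  - rewrite dtay_shift. apply (taylor_bound T d (fun i => w (S i)));
      auto using jet_shift.
Qed.

(** * Regularity along the exact solution *)

Lemma jcont_plus g1 g2 : jcont g1 -> jcont g2 -> jcont (fun t v => g1 t v + g2 t v).
Proof.
  intros H1 H2 t v eps He.
  destruct (H1 t v (eps / 2)) as (d1 & Hd1 & K1); [lra|].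
  destruct (H2 t v (eps / 2)) as (d2 & Hd2 & K2); [lra|].
  exists (Rmin d1 d2); split; [now apply Rmin_glb_lt|]. intros t' v' Ht Hv.
  assert (B1 := Rmin_l d1 d2). assert (B2 := Rmin_r d1 d2).
  specialize (K1 t' v' ltac:(lra) ltac:(lra)). specialize (K2 t' v' ltac:(lra) ltac:(lra)).
  replace (_ - _) with ((g1 t' v' - g1 t v) + (g2 t' v' - g2 t v)) by ring.
  eapply Rle_lt_trans; [apply Rabs_triang|lra].
Qed.

Lemma jcont_mult g1 g2 : jcont g1 -> jcont g2 -> jcont (fun t v => g1 t v * g2 t v).
Proof.
  intros H1 H2 t v eps He.
  set (A := Rabs (g1 t v)). set (B := Rabs (g2 t v)).
  assert (HA : 0 <= A) by apply Rabs_pos. assert (HB : 0 <= B) by apply Rabs_pos.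
  set (r := eps / (A + B + 1 + eps)).
  assert (Hr : 0 < r) by (unfold r; apply Rdiv_lt_0_compat; lra).
  assert (Hr1 : r * (A + B + 1 + eps) = eps) by (unfold r; field; lra).
  assert (Hr2 : r < 1) by nra.
  destruct (H1 t v r Hr) as (d1 & Hd1 & K1).
  destruct (H2 t v r Hr) as (d2 & Hd2 & K2).
  exists (Rmin d1 d2); split; [now apply Rmin_glb_lt|]. intros t' v' Ht Hv.
  assert (B1 := Rmin_l d1 d2). assert (B2 := Rmin_r d1 d2).
  specialize (K1 t' v' ltac:(lra) ltac:(lra)). specialize (K2 t' v' ltac:(lra) ltac:(lra)).
  replace (_ - _) with
    ((g1 t' v' - g1 t v) * (g2 t' v' - g2 t v) + (g1 t' v' - g1 t v) * g2 t v
     + g1 t v * (g2 t' v' - g2 t v)) by ring.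
  eapply Rle_lt_trans; [apply Rabs_triang|].
  eapply Rle_lt_trans; [apply Rplus_le_compat_r, Rabs_triang|].
  rewrite !Rabs_mult. fold A B.
  set (x := Rabs (g1 t' v' - g1 t v)) in *. set (z := Rabs (g2 t' v' - g2 t v)) in *.
  assert (0 <= x) by apply Rabs_pos. assert (0 <= z) by apply Rabs_pos. nra.
Qed.

Lemma Ck_jcont k g : Ck k g -> jcont g.
Proof. destruct k; simpl; tauto. Qed.

Lemma Ck_pred k g : Ck (S k) g -> Ck k g.
Proof.
  revert g; induction k as [|k IH]; intros g (Hc & gt & gu & H1 & H2 & H3 & H4); simpl; [easy|].
  split; [easy|]. exists gt, gu. auto.
Qed.

Lemma Ck_le k l g : (k <= l)%nat -> Ck l g -> Ck k g.
Proof. induction 1; auto using Ck_pred. Qed.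

Lemma Ck_plus k g1 g2 : Ck k g1 -> Ck k g2 -> Ck k (fun t v => g1 t v + g2 t v).
Proof.
  revert g1 g2; induction k as [|k IH]; intros g1 g2 H1 H2.
  - now apply jcont_plus.
  - destruct H1 as (C1 & t1 & u1 & T1 & U1 & A1 & B1).
    destruct H2 as (C2 & t2 & u2 & T2 & U2 & A2 & B2).
    split; [now apply jcont_plus|].
    exists (fun t v => t1 t v + t2 t v), (fun t v => u1 t v + u2 t v).
    repeat split; auto; intros t v.
    + apply (derivable_pt_lim_plus (fun s => g1 s v) (fun s => g2 s v)); auto.
    + apply (derivable_pt_lim_plus (fun s => g1 t s) (fun s => g2 t s)); auto.
Qed.

Lemma Ck_mult k g1 g2 : Ck k g1 -> Ck k g2 -> Ck k (fun t v => g1 t v * g2 t v).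
Proof.
  revert g1 g2; induction k as [|k IH]; intros g1 g2 H1 H2.
  - now apply jcont_mult.
  - assert (P1 := Ck_pred _ _ H1). assert (P2 := Ck_pred _ _ H2).
    destruct H1 as (C1 & t1 & u1 & T1 & U1 & A1 & B1).
    destruct H2 as (C2 & t2 & u2 & T2 & U2 & A2 & B2).
    split; [now apply jcont_mult|].
    exists (fun t v => t1 t v * g2 t v + g1 t v * t2 t v),
           (fun t v => u1 t v * g2 t v + g1 t v * u2 t v).
    repeat split; try (apply Ck_plus; now apply IH); intros t v.
    + apply (derivable_pt_lim_mult (fun s => g1 s v) (fun s => g2 s v)); auto.
    + apply (derivable_pt_lim_mult (fun s => g1 t s) (fun s => g2 t s)); auto.
Qed.

Lemma jcont_curve_continuous g (y : R -> R) x :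
  jcont g -> continuous y x -> continuous (fun t => g t (y t)) x.
Proof.
  intros Hg Hy. apply continuity_pt_filterlim. apply continuity_pt_filterlim in Hy.
  intros eps He.
  destruct (Hg x (y x) eps He) as (d & Hd & Hgd).
  destruct (Hy d Hd) as (d' & Hd' & Hyd).
  exists (Rmin d d'); split; [now apply Rmin_glb_lt|].
  intros t [Ht1 Ht2]. simpl in *. unfold Rdist in *.
  assert (B1 := Rmin_l d d'). assert (B2 := Rmin_r d d').
  apply Hgd; [lra|]. apply Hyd. split; [easy|lra].
Qed.

(** Continuity of [gt] upgrades the two partial derivatives to a total differential, to which the
    chain rule applies. *)
Lemma is_derive_curve (g gt gu : R -> R -> R) (y : R -> R) t l :
  (forall t v, derivable_pt_lim (fun s => g s v) t (gt t v)) ->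
  (forall t v, derivable_pt_lim (fun s => g t s) v (gu t v)) ->
  jcont gt -> is_derive y t l ->
  is_derive (fun s => g s (y s)) t (gt t (y t) + gu t (y t) * l).
Proof.
  intros Ht Hu Hc Hy. apply is_derive_Reals. apply is_derive_Reals in Hy.
  replace (gt t (y t) + gu t (y t) * l) with (gt t (y t) * 1 + gu t (y t) * l) by ring.
  apply (derivable_pt_lim_comp_2d g (fun s => s) y t); [|apply derivable_pt_lim_id|easy].
  apply filterdiff_differentiable_pt_lim.
  apply (is_derive_filterdiff g t (y t) gt (gu t (y t))).
  - apply filter_forall. intros z. apply is_derive_Reals, Ht.
  - apply is_derive_Reals, Hu.
  - intros P [eps HP]. destruct (Hc t (y t) eps (cond_pos eps)) as (d & Hd & Hcd).
    exists (mkposreal d Hd). intros [a b] [Ha Hb]. apply HP. now apply Hcd.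
Qed.

(** The derivative along the curve is gt + gu * f, again a function of (t, u) restricted to the same
    curve. The induction therefore runs over [g] and asks nothing of [y] beyond its equation. *)
Lemma smooth_curve T k f y g :
  Ck k f -> (forall x, continuous y x) ->
  (forall t, 0 < t < T -> is_derive y t (f t (y t))) ->
  Ck k g -> smooth T k (fun t => g t (y t)).
Proof.
  intros Hf Hyc HyD. revert g Hf; induction k as [|k IH]; intros g Hf Hg.
  - split; [|easy]. intros x; now apply jcont_curve_continuous.
  - split; [intros x; apply jcont_curve_continuous; [now apply Ck_jcont in Hg|easy]|].
    destruct Hg as (Hc & gt & gu & Ht & Hu & Cgt & Cgu).
    exists (fun t => gt t (y t) + gu t (y t) * f t (y t)). split.
    + intros t Htt. apply is_derive_curve; auto. now apply Ck_jcont in Cgt.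
    + apply Ck_pred in Hf.
      apply (IH (fun t v => gt t v + gu t v * f t v)); [easy|].
      apply Ck_plus; [easy|now apply Ck_mult].
Qed.

(** The gauge given to the compactness theorem is at most 1 / (1 + |g|), so its uniform lower bound
    [e] yields the bound [/ e] for [g]. *)
Lemma jcont_bounded g a b c d :
  jcont g -> exists M, 0 <= M /\
    forall t v, a <= t <= b -> c <= v <= d -> Rabs (g t v) <= M.
Proof.
  intros Hg.
  assert (Hdel : forall t v, exists del : posreal, del <= / (1 + Rabs (g t v)) /\
     forall t' v', Rabs (t' - t) < del -> Rabs (v' - v) < del ->
       Rabs (g t' v' - g t v) < 1).
  { intros t v. destruct (Hg t v 1 ltac:(lra)) as (e & He & Hge).
    assert (Hp : 0 < / (1 + Rabs (g t v)))
      by (apply Rinv_0_lt_compat; assert (H := Rabs_pos (g t v)); lra).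
    exists (mkposreal (Rmin e (/ (1 + Rabs (g t v)))) (Rmin_glb_lt _ _ _ He Hp)); simpl.
    split; [apply Rmin_r|]. intros t' v' H1 H2.
    apply Hge; eapply Rlt_le_trans; eauto; apply Rmin_l. }
  set (del := fun t v => proj1_sig (constructive_indefinite_description _ (Hdel t v))).
  destruct (compactness_value_2d a b c d del) as (e & He).
  exists (/ e). assert (Hep := cond_pos e).
  assert (0 < / e) by (now apply Rinv_0_lt_compat). split; [lra|].
  (* Compactness delivers its gauge point only under a double negation, hence the argument by
     contradiction. *)
  intros t v Ht Hv. apply Rnot_lt_le. intros Hlt.
  apply (He t v Ht Hv). intros (t0 & v0 & _ & _ & H1 & H2 & H3).
  unfold del in *.
  destruct (constructive_indefinite_description _ (Hdel t0 v0)) as (r & Hr1 & Hr2); simpl in *.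
  specialize (Hr2 t v H1 H2).
  assert (Hx := Rabs_triang_inv (g t v) (g t0 v0)).
  assert (0 <= Rabs (g t0 v0)) by apply Rabs_pos.
  assert (1 + Rabs (g t0 v0) <= / e).
  { rewrite <- (Rinv_inv (1 + Rabs (g t0 v0))).
    apply Rinv_le_contravar; lra. }
  lra.
Qed.

(** * The dual solution *)

(** The integrating factor. Its positivity later allows division by the dual weight at the right end
    of a step. *)
Lemma dual_solution a :
  (forall x, continuous a x) ->
  exists z, (forall x, is_derive z x (- a x * z x)) /\ forall x, 0 < z x.
Proof.
  intros Ha. exists (fun x => exp (- RInt a 0 x)). split; [|intros; apply exp_pos].
  intros x.
  assert (HI : is_derive (fun x => RInt a 0 x) x (a x)).
  { apply (is_derive_RInt a (fun x => RInt a 0 x) 0 x); [|apply Ha].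
    apply filter_forall. intros b. apply (RInt_correct (V := R_CompleteNormedModule)).
    apply (ex_RInt_continuous (V := R_CompleteNormedModule)). intros; apply Ha. }
  evar_last.
  - apply (is_derive_comp exp (fun x => - RInt a 0 x) x).
    + apply is_derive_Reals, derivable_pt_lim_exp.
    + apply (is_derive_opp (fun x => RInt a 0 x) x _ HI).
  - unfold scal, opp; simpl. unfold mult; simpl. ring.
Qed.

Lemma dual_smooth T k a z :
  smooth T k a -> (forall x, is_derive z x (- a x * z x)) -> smooth T (S k) z.
Proof.
  intros Ha HD.
  assert (Hc : forall x, continuous z x).
  { intros x. apply (ex_derive_continuous z x). now exists (- a x * z x). }
  induction k as [|k IH].
  - split; [easy|]. exists (fun x => - a x * z x). split; [auto|].
    apply smooth_mult; [now apply smooth_opp|easy].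
  - split; [easy|]. exists (fun x => - a x * z x). split; [auto|].
    apply smooth_mult; [now apply smooth_opp|]. apply IH. now apply smooth_pred.
Qed.

(** [smooth_jet] leaves the first derivative anonymous. Prescribing it identifies remainders at
    index 1 with errors of the right-hand side itself. *)
Lemma smooth_jet_derive T k F F' :
  (forall x, continuous F x) -> (forall x, 0 < x < T -> is_derive F x (F' x)) ->
  smooth T k F' -> exists w, w 0%nat = F /\ w 1%nat = F' /\ jet T (S k) w.
Proof.
  intros Hc HD HF'. destruct (smooth_jet T k F' HF') as (w & Hw0 & Hwc & Hwd).
  exists (fun i => match i with O => F | S i' => w i' end).
  split; [easy|]. split; [easy|]. split.
  - intros [|i] Hi; [easy|apply Hwc; lia].
  - intros [|i] Hi; [rewrite Hw0; easy|apply Hwd; lia].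
Qed.

(** * Local analysis of one step *)

Section LocalError.

Context (p : nat) (tau omega : nat -> R) (Lm Li : nat -> nat -> R)
  (T Lip : R) (f : R -> R -> R) (y : R -> R)
  (Hradau : right_radau p tau omega) (HLm : is_Lmat p tau Lm)
  (HLi : is_inverse p Lm Li) (HLip0 : 0 <= Lip)
  (HLip : forall t x x', Rabs (f t x - f t x') <= Lip * Rabs (x - x'))
  (Hf : Ck (2 * p + 1) f) (Hyc : forall x, continuous y x)
  (HyD : forall t, 0 < t < T -> is_derive y t (f t (y t))).

Let node := tnode tau.
Let W := sum_f_R0 (fun j => Rabs (omega j)) p.
Let A := sum_f_R0 (fun m => sum_f_R0 (fun j => Rabs (Li m j * omega j)) p) p.

(* The right-hand side of the discontinuous Galerkin equations solved for the
   nodal values; the sweeps of the scheme are perturbed Picard iterations of it. *)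
Definition dg_map (tn dt un : R) (U : nat -> R) (m : nat) : R :=
  un - dt / 2 * sum_f_R0 (fun j => Li m j * omega j * f (tnode tau tn dt j) (U j)) p.

Definition in_range (tn dt h : R) : Prop := 0 <= tn /\ 0 < dt <= h /\ tn + dt <= T.

Lemma in_range_le tn dt h h' : h <= h' -> in_range tn dt h -> in_range tn dt h'.
Proof. unfold in_range; lra. Qed.

Lemma W_nonneg : 0 <= W.
Proof. apply sum_nonneg; intros; apply Rabs_pos. Qed.

Lemma A_nonneg : 0 <= A.
Proof. apply sum_nonneg; intros; apply sum_nonneg; intros; apply Rabs_pos. Qed.

Lemma node_range tn dt m : 0 < dt -> (m <= p)%nat -> tn <= node tn dt m <= tn + dt.
Proof.
  intros Hdt Hm. destruct (radau_tau_range p tau omega m Hradau Hm).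
  unfold node, tnode. nra.
Qed.

Lemma node_last tn dt : node tn dt p = tn + dt.
Proof.
  unfold node, tnode. replace (tau p) with 1 by (symmetry; apply Hradau). field.
Qed.

Lemma node_step tn dt m : 0 < dt -> (m < p)%nat -> 0 <= node tn dt (S m) - node tn dt m <= dt.
Proof.
  intros Hdt Hm.
  assert (H1 := node_range tn dt m Hdt ltac:(lia)).
  assert (H2 := node_range tn dt (S m) Hdt ltac:(lia)).
  assert (H3 := radau_tau_lt p tau omega m (S m) Hradau ltac:(lia) ltac:(lia)).
  split; [|lra]. unfold node, tnode. nra.
Qed.

Lemma weighted_row_le m (x : nat -> R) B :
  (m <= p)%nat -> (forall j, (j <= p)%nat -> Rabs (x j) <= B) ->
  Rabs (sum_f_R0 (fun j => Li m j * omega j * x j) p) <= A * B.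
Proof.
  intros Hm Hx.
  assert (0 <= B) by (apply Rle_trans with (Rabs (x 0%nat)); [apply Rabs_pos|apply Hx; lia]).
  eapply Rle_trans; [apply (sum_weighted_le p (fun j => Li m j * omega j) x B Hx)|].
  apply Rmult_le_compat_r; [easy|].
  apply (sum_term_le p (fun m => sum_f_R0 (fun j => Rabs (Li m j * omega j)) p)); [|easy].
  intros; apply sum_nonneg; intros; apply Rabs_pos.
Qed.

(** * Consistency of the exact solution with the discontinuous Galerkin equations *)

Lemma exact_jet :
  exists w M, w 0%nat = y /\ w 1%nat = (fun t => f t (y t)) /\ jet T (2 * p + 2) w /\ 0 <= M /\
    forall i, (i <= 2 * p + 2)%nat -> forall x, 0 <= x <= T -> Rabs (w i x) <= M.
Proof.
  destruct (smooth_jet_derive T (2 * p + 1) y (fun t => f t (y t))) as (w & H0 & H1 & Hj); auto.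
  { now apply (smooth_curve T (2 * p + 1) f y f). }
  replace (S (2 * p + 1)) with (2 * p + 2)%nat in Hj by lia.
  destruct (jet_bounded T _ w Hj) as (M & HM & Hb). exists w, M. auto.
Qed.

(** The Taylor polynomial of degree p + 1 satisfies the equations exactly by [radau_stage_exact].
    What is left is its remainder, dt^(p+2) in the values and dt * dt^(p+1) in the slopes. *)
Lemma stage_residual :
  exists C, 0 <= C /\ forall tn dt m, in_range tn dt 1 -> (m <= p)%nat ->
    Rabs (y (node tn dt m) - y tn
      + dt / 2 * sum_f_R0 (fun j => Li m j * omega j *
                   f (node tn dt j) (y (node tn dt j))) p) <= C * dt ^ (p + 2).
Proof.
  destruct exact_jet as (w & M & H0 & H1 & Hj & HM & Hb).
  assert (HA := A_nonneg).
  exists (M + A * M). split; [nra|]. intros tn dt m (Htn & Hdt & HT) Hm.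
  set (S_ := tay w tn (S p)). set (S' := dtay w tn (S p)).
  assert (Hpow : forall k x, tn <= x <= tn + dt -> Rabs (x - tn) ^ k <= dt ^ k).
  { intros k x Hx. apply pow_incr. split; [apply Rabs_pos|]. apply Rabs_le; lra. }
  assert (HR : forall x, tn <= x <= tn + dt -> Rabs (y x - S_ x) <= M * dt ^ (p + 2)).
  { intros x Hx. rewrite <- H0. unfold S_. replace (p + 2)%nat with (S (S p)) by lia.
    eapply Rle_trans; [apply (taylor_bound T (S p) w M tn x)|].
    - apply jet_le with (2 * p + 2)%nat; [lia|easy].
    - intros; apply Hb; [lia|easy].
    - lra.
    - lra.
    - apply Rmult_le_compat_l; [easy|now apply Hpow]. }
  assert (HR' : forall x, tn <= x <= tn + dt -> Rabs (f x (y x) - S' x) <= M * dt ^ (p + 1)).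
  { intros x Hx. replace (f x (y x)) with (w 1%nat x) by now rewrite H1.
    unfold S'. replace (p + 1)%nat with (S p) by lia.
    eapply Rle_trans; [apply (taylor_derive_bound T (S p) w M tn x)|].
    - apply jet_le with (2 * p + 2)%nat; [lia|easy].
    - intros; apply Hb; [lia|easy].
    - lra.
    - lra.
    - apply Rmult_le_compat_l; [easy|now apply Hpow]. }
  assert (Hex := radau_stage_exact p tau omega Lm Li
    (fun x => S_ (dt / 2 * x + (tn + dt / 2)))
    (fun x => dt / 2 * S' (dt / 2 * x + (tn + dt / 2))) m Hradau HLm HLi).
  cbv beta in Hex.
  replace (dt / 2 * -1 + (tn + dt / 2)) with tn in Hex by field.
  assert (Hnode : forall j, dt / 2 * tau j + (tn + dt / 2) = node tn dt j)
    by (intros; unfold node, tnode; field).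
  assert (Hcen : S_ tn = y tn) by (unfold S_; now rewrite tay_center, H0).
  rewrite Hnode, Hcen in Hex.
  rewrite (sum_eq _ (fun j => dt / 2 * (Li m j * omega j * S' (node tn dt j)))) in Hex
    by (intros; rewrite Hnode; ring).
  rewrite sum_scal_l in Hex.
  rewrite (sum_eq _ (fun j => Li m j * omega j * S' (node tn dt j)
     + Li m j * omega j * (f (node tn dt j) (y (node tn dt j)) - S' (node tn dt j))))
    by (intros; ring).
  rewrite sum_plus, Rmult_plus_distr_l, Hex; try easy.
  - replace (y (node tn dt m) - y tn + (y tn - S_ (node tn dt m) + _)) with
      ((y (node tn dt m) - S_ (node tn dt m)) + dt / 2 * sum_f_R0 (fun j => Li m j * omega j *
        (f (node tn dt j) (y (node tn dt j)) - S' (node tn dt j))) p) by ring.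
    eapply Rle_trans; [apply Rabs_triang|].
    assert (Hn := node_range tn dt m ltac:(lra) Hm).
    assert (B1 := HR _ Hn).
    assert (B2 := weighted_row_le m (fun j => f (node tn dt j) (y (node tn dt j)) - S' (node tn dt j))
       (M * dt ^ (p + 1)) Hm).
    cbv beta in B2. rewrite Rabs_mult, (Rabs_right (dt / 2)) by lra.
    assert (B3 : dt / 2 * (A * (M * dt ^ (p + 1))) <= A * M * dt ^ (p + 2)).
    { replace (p + 2)%nat with (S (p + 1)) by lia. simpl (dt ^ S _).
      assert (0 <= dt ^ (p + 1)) by (apply pow_le; lra).
      assert (0 <= A * M) by nra. assert (0 <= A * M * dt ^ (p + 1)) by nra. nra. }
    assert (B4 : dt / 2 * Rabs (sum_f_R0 (fun j => Li m j * omega j *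
        (f (node tn dt j) (y (node tn dt j)) - S' (node tn dt j))) p)
        <= dt / 2 * (A * (M * dt ^ (p + 1)))).
    { apply Rmult_le_compat_l; [lra|]. apply B2. intros j Hj'. apply HR', node_range; [lra|easy]. }
    lra.
  - apply polyd_affine, tay_polyd.
  - intros x. evar_last.
    + apply (is_derive_comp S_ (fun x => dt / 2 * x + (tn + dt / 2)) x).
      * apply is_derive_tay.
      * auto_derive; [easy|reflexivity].
    + unfold scal; simpl; unfold mult; simpl. unfold S'. ring.
Qed.

(** The instance Y(x) = x of [radau_stage_exact]: a Picard step with constant slope lands on a
    straight line, the same line that the Euler iterate follows. *)
Lemma dg_row_sum m : (m <= p)%nat ->
  sum_f_R0 (fun j => Li m j * omega j) p = - (tau m + 1).
Proof.
  intros Hm.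
  assert (H := radau_stage_exact p tau omega Lm Li (fun x => x) (fun _ => 1) m Hradau HLm HLi).
  cbv beta in H.
  rewrite (sum_eq _ (fun j => Li m j * omega j)) in H by (intros; ring).
  rewrite H; [ring| | |easy].
  - apply polyd_le with 1%nat; [lia|].
    apply polyd_ext with (fun x => 1 * x + 0); [intros; ring|apply polyd_linear].
  - intros x. apply (is_derive_id x).
Qed.

(** The exact slope at the left end is the common reference for the Euler iterate and the first
    sweep; deviations from it are of size dt + |x - y(tn)|, and one more factor dt comes from the
    step. *)
Lemma slope_bound :
  exists B, 0 <= B /\ forall tn dt t x, in_range tn dt 1 -> tn <= t <= tn + dt ->
    Rabs (f t x - f tn (y tn)) <= B * (dt + Rabs (x - y tn)) /\
    Rabs (f tn (y tn)) <= B /\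
    Rabs (y t - y tn - (t - tn) * f tn (y tn)) <= B * dt ^ 2.
Proof.
  destruct exact_jet as (w & M & H0 & H1 & Hj & HM & Hb).
  exists (Lip + Lip * M + M). split; [nra|].
  intros tn dt t x (Htn & Hdt & HT) Ht.
  assert (Habs : Rabs (t - tn) <= dt) by (apply Rabs_le; lra).
  assert (Habs0 := Rabs_pos (t - tn)).
  assert (By : Rabs (y t - y tn) <= M * dt).
  { apply Rle_trans with (M * Rabs (t - tn)); [|nra].
    apply (mean_value_bound T y (w 1%nat)); auto; try lra.
    - intros; rewrite H1; now apply HyD.
    - intros z Hz. apply Hb; [lia|].
      revert Hz. unfold Rmin, Rmax. destruct (Rle_dec tn t); lra. }
  assert (Bv : Rabs (f t (y t) - f tn (y tn)) <= M * dt).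
  { apply Rle_trans with (M * Rabs (t - tn)); [|nra].
    replace (f t (y t)) with (w 1%nat t) by now rewrite H1.
    replace (f tn (y tn)) with (w 1%nat tn) by now rewrite H1.
    apply (mean_value_bound T (w 1%nat) (w 2%nat)); try lra.
    - intros z; apply Hj; lia.
    - intros z Hz; apply Hj; [lia|easy].
    - intros z Hz. apply Hb; [lia|].
      revert Hz. unfold Rmin, Rmax. destruct (Rle_dec tn t); lra. }
  split; [|split].
  - replace (f t x - f tn (y tn)) with
      ((f t x - f t (y t)) + (f t (y t) - f tn (y tn))) by ring.
    eapply Rle_trans; [apply Rabs_triang|].
    assert (HL := HLip t x (y t)).
    assert (HT2 : Rabs (x - y t) <= Rabs (x - y tn) + Rabs (y t - y tn)).
    { replace (x - y t) with ((x - y tn) - (y t - y tn)) by ring.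
      eapply Rle_trans; [apply Rabs_triang|]. rewrite Rabs_Ropp. lra. }
    assert (Hx := Rabs_pos (x - y tn)).
    assert (Lip * Rabs (x - y t) <= Lip * (Rabs (x - y tn) + M * dt))
      by (apply Rmult_le_compat_l; lra).
    assert (0 <= Lip * M) by nra.
    assert (0 <= Lip * dt) by nra.
    assert (0 <= Lip * M * Rabs (x - y tn)) by nra.
    assert (0 <= M * Rabs (x - y tn)) by nra. nra.
  - assert (Hv : Rabs (w 1%nat tn) <= M) by (apply Hb; [lia|lra]).
    rewrite H1 in Hv. nra.
  - apply Rle_trans with (M * dt ^ 2).
    + assert (HTy := taylor_bound T 1 w M tn t).
      unfold tay in HTy. simpl sum_f_R0 in HTy. rewrite H0, H1 in HTy.
      replace (y t - y tn - (t - tn) * f tn (y tn)) with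
        (y t - (y tn / INR (fact 0) * (t - tn) ^ 0 + f tn (y tn) / INR (fact 1) * (t - tn) ^ 1))
        by (simpl; field).
      eapply Rle_trans; [apply HTy|].
      * apply jet_le with (2 * p + 2)%nat; [lia|easy].
      * intros; apply Hb; [lia|easy].
      * lra.
      * lra.
      * apply Rmult_le_compat_l; [easy|]. apply pow_incr. lra.
    + assert (0 <= dt ^ 2) by (apply pow_le; lra). assert (0 <= Lip * M) by nra.
      apply Rmult_le_compat_r; [easy|]. lra.
Qed.

(** * The Euler initial iterates *)

(** One lemma covers both variants: the disjunction on [g] lets the slope be taken at the old or at
    the new point. The deviation from the reference line grows by a fixed affine map of [c]. *)
Lemma euler_substep :
  exists B, 0 <= B /\ forall tn dt un s s' x x' g c,
    in_range tn dt 1 -> 2 * B * dt <= 1 -> 0 <= c ->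
    tn <= s <= tn + dt -> tn <= s' <= tn + dt -> 0 <= s' - s ->
    Rabs (x - un - (s - tn) * f tn (y tn)) <= c * (dt * (dt + Rabs (un - y tn))) ->
    x' = x + (s' - s) * g -> (g = f s x \/ g = f s' x') ->
    Rabs (x' - un - (s' - tn) * f tn (y tn))
      <= ((2 + B) * c + B) * (dt * (dt + Rabs (un - y tn))).
Proof.
  (* With this constant the hypothesis on [dt] gives 8 * B * dt <= 1 for the inner [B], enough for
     the absorption in the implicit case. *)
  destruct slope_bound as (B & HB & Hs). exists (4 * B * (1 + B)). split; [nra|].
  intros tn dt un s s' x x' g c Hr HBdt Hc Hsr Hsr' Hss Hx Hx' Hg.
  set (v0 := f tn (y tn)) in *. set (E := Rabs (un - y tn)) in *.
  assert (HE : 0 <= E) by apply Rabs_pos.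
  assert (Hr' := Hr). destruct Hr' as (Htn & Hdt & HT).
  set (eta := dt + E). assert (Heta : 0 <= eta) by (unfold eta; lra).
  assert (Hv0 : Rabs v0 <= B) by (now apply (Hs tn dt s x)).
  assert (Hdist : forall r X, tn <= r <= tn + dt ->
     Rabs (X - y tn) <= Rabs (X - un - (r - tn) * v0) + (1 + B) * eta).
  { intros r X Hrr.
    replace (X - y tn) with ((X - un - (r - tn) * v0) + ((un - y tn) + (r - tn) * v0)) by ring.
    eapply Rle_trans; [apply Rabs_triang|]. apply Rplus_le_compat_l.
    eapply Rle_trans; [apply Rabs_triang|]. fold E. rewrite Rabs_mult, (Rabs_right (r - tn)) by lra.
    assert (0 <= Rabs v0) by apply Rabs_pos.
    assert ((r - tn) * Rabs v0 <= dt * B) by nra. unfold eta. nra. }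
  fold eta in Hx |- *.
  assert (Hd : x' - un - (s' - tn) * v0 = (x - un - (s - tn) * v0) + (s' - s) * (g - v0))
    by (rewrite Hx'; ring).
  set (w := Rabs (x - un - (s - tn) * v0)) in *.
  set (w' := Rabs (x' - un - (s' - tn) * v0)) in *.
  assert (Hw : 0 <= w) by apply Rabs_pos. assert (Hw' : 0 <= w') by apply Rabs_pos.
  assert (Hww : w' <= w + dt * Rabs (g - v0)).
  { unfold w' at 1. rewrite Hd. eapply Rle_trans; [apply Rabs_triang|]. fold w.
    rewrite Rabs_mult, (Rabs_right (s' - s)) by lra.
    assert (0 <= Rabs (g - v0)) by apply Rabs_pos. nra. }
  assert (Hbase : 0 <= dt * eta) by nra.
  assert (HBB : 0 <= B * (dt * eta)) by nra.
  assert (HBBB : 0 <= B * B * (dt * eta)) by (apply Rmult_le_pos; nra).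
  assert (Hcb : 0 <= c * (dt * eta)) by nra.
  assert (Hcbb : 0 <= B * (c * (dt * eta))) by nra.
  assert (Hcbbb : 0 <= B * B * (c * (dt * eta))) by (apply Rmult_le_pos; nra).
  destruct Hg as [-> | ->].
  - assert (Hgb := proj1 (Hs tn dt s x Hr Hsr)). fold v0 in Hgb.
    assert (Hdx := Hdist s x Hsr). fold w in Hdx.
    assert (Hg2 : Rabs (f s x - v0) <= B * (eta + w + (1 + B) * eta)).
    { eapply Rle_trans; [exact Hgb|]. apply Rmult_le_compat_l; [easy|]. unfold eta in *. lra. }
    assert (dt * Rabs (f s x - v0) <= dt * (B * (eta + w + (1 + B) * eta)))
      by (apply Rmult_le_compat_l; lra).
    assert (dt * (B * w) <= B * (c * (dt * eta))).
    { replace (B * (c * (dt * eta))) with ((c * (dt * eta)) * B) by ring.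
      assert (dt * (B * w) <= B * w) by (assert (0 <= B * w) by nra; nra). nra. }
    replace (dt * (B * (eta + w + (1 + B) * eta))) with
      (2 * (B * (dt * eta)) + B * B * (dt * eta) + dt * (B * w)) in * by ring.
    replace (((2 + 4 * B * (1 + B)) * c + 4 * B * (1 + B)) * (dt * eta)) with
      (2 * (c * (dt * eta)) + 4 * (B * (c * (dt * eta))) + 4 * (B * B * (c * (dt * eta)))
       + 4 * (B * (dt * eta)) + 4 * (B * B * (dt * eta))) by ring.
    lra.
  - assert (Hgb := proj1 (Hs tn dt s' x' Hr Hsr')). fold v0 in Hgb.
    assert (Hdx := Hdist s' x' Hsr'). fold w' in Hdx.
    assert (Hg2 : Rabs (f s' x' - v0) <= B * (eta + w' + (1 + B) * eta)).
    { eapply Rle_trans; [exact Hgb|]. apply Rmult_le_compat_l; [easy|]. unfold eta in *. lra. }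
    assert (dt * Rabs (f s' x' - v0) <= dt * (B * (eta + w' + (1 + B) * eta)))
      by (apply Rmult_le_compat_l; lra).
    (* The implicit slope brings the unknown deviation [w'] back on the right-hand side; for small
       [dt] it is absorbed on the left. *)
    assert (dt * B * w' <= w' / 4).
    { assert (0 <= B * B * dt) by (apply Rmult_le_pos; nra).
      assert (4 * (B * dt) <= 1) by nra. nra. }
    replace (dt * (B * (eta + w' + (1 + B) * eta))) with
      (2 * (B * (dt * eta)) + B * B * (dt * eta) + dt * B * w') in * by ring.
    replace (((2 + 4 * B * (1 + B)) * c + 4 * B * (1 + B)) * (dt * eta)) with
      (2 * (c * (dt * eta)) + 4 * (B * (c * (dt * eta))) + 4 * (B * B * (c * (dt * eta)))
       + 4 * (B * (dt * eta)) + 4 * (B * B * (dt * eta))) by ring.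
    lra.
Qed.

Lemma euler_initial :
  exists C h0, 0 <= C /\ 0 < h0 <= 1 /\
    forall (expl : bool) tn dt un (U : nat -> R), in_range tn dt h0 ->
    (if expl then
       U O = un + (node tn dt O - tn) * f tn un /\
       (forall m, (m < p)%nat ->
          U (S m) = U m + (node tn dt (S m) - node tn dt m) * f (node tn dt m) (U m))
     else
       U O = un + (node tn dt O - tn) * f (node tn dt O) (U O) /\
       (forall m, (m < p)%nat ->
          U (S m) = U m + (node tn dt (S m) - node tn dt m) * f (node tn dt (S m)) (U (S m)))) ->
    forall m, (m <= p)%nat ->
      Rabs (U m - un - (node tn dt m - tn) * f tn (y tn))
        <= C * (dt * (dt + Rabs (un - y tn))).
Proof.
  destruct euler_substep as (B & HB & Hstep).
  set (h0 := Rmin 1 (/ (2 * B + 1))).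
  assert (Hi : 0 < / (2 * B + 1)) by (apply Rinv_0_lt_compat; lra).
  (* The recursion c -> (2 + B) c + B, started at 0, stays below B (3 + B)^m, since the additive B
     is at most the current bound. *)
  exists (B * (3 + B) ^ p), h0. split; [|split; [split|]].
  - apply Rmult_le_pos; [easy|apply pow_le; lra].
  - apply Rmin_glb_lt; lra.
  - apply Rmin_l.
  - intros expl tn dt un U Hr HU.
    assert (Hh1 : h0 <= 1) by apply Rmin_l.
    assert (Hh2 : h0 <= / (2 * B + 1)) by apply Rmin_r.
    assert (Hr1 : in_range tn dt 1) by (now apply in_range_le with h0).
    assert (Hr2 := Hr). destruct Hr2 as (Htn & Hdt & HT).
    assert (HBdt : 2 * B * dt <= 1).
    { assert ((2 * B + 1) * dt <= (2 * B + 1) * / (2 * B + 1))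
        by (apply Rmult_le_compat_l; lra).
      rewrite Rinv_r in H by lra. nra. }
    assert (HE := Rabs_pos (un - y tn)).
    assert (Hbase : 0 <= dt * (dt + Rabs (un - y tn))) by nra.
    assert (Hind : forall m, (m <= p)%nat ->
      Rabs (U m - un - (node tn dt m - tn) * f tn (y tn))
        <= (B * (3 + B) ^ m) * (dt * (dt + Rabs (un - y tn)))).
    { induction m as [|m IH]; intros Hm.
      - assert (Hn := node_range tn dt 0 ltac:(lra) Hm).
        (* The step from [tn] to the first node is the substep that starts at the point (tn, un),
           with deviation 0. *)
        replace (B * (3 + B) ^ 0) with ((2 + B) * 0 + B) by (simpl; ring).
        assert (H0 : Rabs (un - un - (tn - tn) * f tn (y tn))
                     <= 0 * (dt * (dt + Rabs (un - y tn)))).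
        { replace (un - un - (tn - tn) * f tn (y tn)) with 0 by ring. rewrite Rabs_R0; lra. }
        destruct expl; destruct HU as [HU _].
        + apply (Hstep tn dt un tn (node tn dt 0) un (U 0%nat) (f tn un) 0); auto; lra.
        + apply (Hstep tn dt un tn (node tn dt 0) un (U 0%nat)
                   (f (node tn dt 0) (U 0%nat)) 0); auto; lra.
      - assert (Hn := node_range tn dt m ltac:(lra) ltac:(lia)).
        assert (Hn' := node_range tn dt (S m) ltac:(lra) ltac:(lia)).
        assert (Hns := node_step tn dt m ltac:(lra) ltac:(lia)).
        specialize (IH ltac:(lia)).
        set (q := (3 + B) ^ m) in *.
        assert (Hq : 1 <= q) by (apply pow_R1_Rle; lra).
        apply Rle_trans with (((2 + B) * (B * q) + B) * (dt * (dt + Rabs (un - y tn)))).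
        + destruct expl; destruct HU as [_ HU]; specialize (HU m ltac:(lia)).
          * apply (Hstep tn dt un (node tn dt m) (node tn dt (S m)) (U m) (U (S m))
              (f (node tn dt m) (U m)) (B * q)); auto; try lra; nra.
          * apply (Hstep tn dt un (node tn dt m) (node tn dt (S m)) (U m) (U (S m))
              (f (node tn dt (S m)) (U (S m))) (B * q)); auto; try lra; nra.
        + apply Rmult_le_compat_r; [easy|]. simpl. fold q. nra. }
    intros m Hm. eapply Rle_trans; [now apply Hind|].
    apply Rmult_le_compat_r; [easy|]. apply Rmult_le_compat_l; [easy|].
    apply Rle_pow; [lra|easy].
Qed.

(** * Sweeps as perturbed Picard iterations *)

(** The rows of [Ltilde] are consecutive differences of the rows of - L^-1, so adding the node
    equations telescopes them to [dg_map]. The correction terms pile up to a partial sum of weighted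
    slope differences, which is the whole perturbation. *)
Lemma sdg_sweep (expl : bool) tn dt un (V U : nat -> R) :
  0 < dt ->
  (let F := fun X j => f (node tn dt j) (X j) in
   let Sg := fun i => sum_f_R0 (fun j => Ltilde Li i j * omega j * F V j) p in
   if expl then
     U O = un + dt / 2 * Sg O /\
     (forall m, (m < p)%nat ->
        U (S m) = U m + dt / 2 * omega m * (F U m - F V m) + dt / 2 * Sg (S m))
   else
     U O = un + dt / 2 * omega O * (F U O - F V O) + dt / 2 * Sg O /\
     (forall m, (m < p)%nat ->
        U (S m) = U m + dt / 2 * omega (S m) * (F U (S m) - F V (S m))
                  + dt / 2 * Sg (S m))) ->
  forall m, (m <= p)%nat ->
    Rabs (U m - dg_map tn dt un V m)
      <= dt / 2 * (Lip * W) * sum_f_R0 (fun l => Rabs (U l - V l)) p.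
Proof.
  intros Hdt HU.
  set (X := fun l => omega l * (f (node tn dt l) (U l) - f (node tn dt l) (V l))).
  assert (HX : forall l, (l <= p)%nat -> Rabs (X l) <= Lip * W * Rabs (U l - V l)).
  { intros l Hl. unfold X. rewrite Rabs_mult.
    replace (Lip * W * Rabs (U l - V l)) with (W * (Lip * Rabs (U l - V l))) by ring.
    apply Rmult_le_compat; try apply Rabs_pos; [|apply HLip].
    apply (sum_term_le p (fun j => Rabs (omega j))); [intros; apply Rabs_pos|easy]. }
  assert (HG : exists G : nat -> R,
    (forall m, (m <= p)%nat -> U m - dg_map tn dt un V m = dt / 2 * G m) /\
    (forall m, (m <= p)%nat -> Rabs (G m) <= sum_f_R0 (fun l => Rabs (X l)) p)).
  { assert (Hpart : forall m, (m <= p)%nat ->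
      Rabs (sum_f_R0 X m) <= sum_f_R0 (fun l => Rabs (X l)) p).
    { intros m Hm. eapply Rle_trans; [apply Rsum_abs|].
      apply sum_le_range; [intros; apply Rabs_pos|easy]. }
    assert (HLt0 : forall F : nat -> R, sum_f_R0 (fun j => Ltilde Li 0 j * omega j * F j) p
        = - sum_f_R0 (fun j => Li 0%nat j * omega j * F j) p).
    { intros F. replace (- _) with (-1 * sum_f_R0 (fun j => Li 0%nat j * omega j * F j) p) by ring.
      rewrite <- sum_scal_l. apply sum_eq. intros; simpl; ring. }
    assert (HLtS : forall m (F : nat -> R),
        sum_f_R0 (fun j => Ltilde Li (S m) j * omega j * F j) p
        = sum_f_R0 (fun j => Li m j * omega j * F j) p
          - sum_f_R0 (fun j => Li (S m) j * omega j * F j) p).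
    { intros m F. rewrite <- sum_minus_distr. apply sum_eq. intros; simpl; ring. }
    cbv zeta beta in HU. destruct expl; destruct HU as [HU0 HUS].
    (* The explicit sweep corrects with the node just left, so its partial sum lags by one index and
       is empty at node 0; in the implicit sweep it includes the current node. *)
    - exists (fun m => match m with O => 0 | S m' => sum_f_R0 X m' end). split.
      + induction m as [|m IH]; intros Hm.
        * rewrite HU0, HLt0. unfold dg_map. fold (node tn dt). ring.
        * rewrite HUS, HLtS by lia. specialize (IH ltac:(lia)).
          unfold dg_map in *. fold (node tn dt) in *.
          destruct m as [|m]; simpl in IH |- *; unfold X in *; lra.
      + intros [|m] Hm; [|apply Hpart; lia].
        rewrite Rabs_R0. apply sum_nonneg; intros; apply Rabs_pos.
    - exists (fun m => sum_f_R0 X m). split; [|easy].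
      induction m as [|m IH]; intros Hm.
      + rewrite HU0, HLt0. unfold dg_map. simpl. unfold X. fold (node tn dt). ring.
      + rewrite HUS, HLtS by lia. specialize (IH ltac:(lia)).
        unfold dg_map in *. fold (node tn dt) in *. simpl.
        unfold X at 2. lra. }
  destruct HG as (G & HG1 & HG2). intros m Hm.
  rewrite HG1 by easy. rewrite Rabs_mult, (Rabs_right (dt / 2)) by lra.
  rewrite Rmult_assoc. apply Rmult_le_compat_l; [lra|].
  eapply Rle_trans; [now apply HG2|].
  rewrite <- sum_scal_l. now apply sum_Rle.
Qed.

Lemma dg_map_lip tn dt un U V B m :
  0 < dt -> (m <= p)%nat -> (forall j, (j <= p)%nat -> Rabs (U j - V j) <= B) ->
  Rabs (dg_map tn dt un U m - dg_map tn dt un V m) <= dt / 2 * (A * Lip) * B.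
Proof.
  intros Hdt Hm HB. unfold dg_map.
  replace (_ - _) with (- (dt / 2) * (sum_f_R0 (fun j => Li m j * omega j * f (tnode tau tn dt j) (U j)) p
    - sum_f_R0 (fun j => Li m j * omega j * f (tnode tau tn dt j) (V j)) p)) by ring.
  rewrite <- sum_minus_distr, Rabs_mult, Rabs_Ropp, (Rabs_right (dt / 2)) by lra.
  rewrite (sum_eq _ (fun j => Li m j * omega j *
     (f (tnode tau tn dt j) (U j) - f (tnode tau tn dt j) (V j)))) by (intros; ring).
  replace (dt / 2 * (A * Lip) * B) with (dt / 2 * (A * (Lip * B))) by ring.
  apply Rmult_le_compat_l; [lra|].
  apply (weighted_row_le m (fun j => f (tnode tau tn dt j) (U j) - f (tnode tau tn dt j) (V j)));
    [easy|].
  intros j Hj. eapply Rle_trans; [apply HLip|].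
  apply Rmult_le_compat_l; [easy|now apply HB].
Qed.

Lemma small_step c : 0 <= c -> exists h, 0 < h <= 1 /\
  forall dt, 0 < dt <= h -> INR (S p) * (dt / 2 * c) <= 1 / 2.
Proof.
  intros Hc. assert (HS : 0 < INR (S p)) by (apply lt_0_INR; lia).
  set (q := INR (S p) * c + 1). assert (Hq : 1 <= q) by (unfold q; nra).
  exists (/ q). assert (Hiq : 0 < / q) by (apply Rinv_0_lt_compat; lra).
  assert (Hqq : / q * q = 1) by (apply Rinv_l; lra).
  split; [split; [easy|nra]|]. intros dt Hdt.
  assert (dt * q <= 1) by nra. unfold q in *. nra.
Qed.

(** The common consequence of the explicit and the implicit sweep; the analysis of the iteration
    uses nothing else about them. *)
Definition sweeps (K : nat) (tn dt un : R) (U : nat -> nat -> R) : Prop :=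
  forall k, (k < K)%nat -> forall m, (m <= p)%nat ->
    Rabs (U (S k) m - dg_map tn dt un (U k) m)
      <= dt / 2 * (Lip * W) * sum_f_R0 (fun l => Rabs (U (S k) l - U k l)) p.

(** For the first increment, both U^0 and its Picard image lie within dt * (dt + |E|) of the
    reference line. Later increments are differences of two Picard images plus two perturbations,
    each carrying a factor dt; the perturbation containing the new increment is absorbed by
    [sum_absorb]. *)
Lemma sweep_increment C0 K :
  0 <= C0 ->
  exists C h0, 0 <= C /\ 0 < h0 <= 1 /\ forall tn dt un U, in_range tn dt h0 ->
    (forall m, (m <= p)%nat ->
      Rabs (U O m - un - (node tn dt m - tn) * f tn (y tn))
        <= C0 * (dt * (dt + Rabs (un - y tn)))) ->
    sweeps K tn dt un U ->
    forall k, (k < K)%nat -> forall m, (m <= p)%nat ->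
      Rabs (U (S k) m - U k m) <= C * (dt ^ S k * (dt + Rabs (un - y tn))).
Proof.
  intros HC0. destruct slope_bound as (B & HB & Hs).
  assert (HW := W_nonneg). assert (HA := A_nonneg).
  assert (HLW : 0 <= Lip * W) by nra. assert (HAL : 0 <= A * Lip) by nra.
  destruct (small_step (Lip * W) HLW) as (h0 & Hh0 & Hsmall).
  set (s := INR (S p)). assert (Hs0 : 1 <= s) by (unfold s; rewrite S_INR; assert (H := pos_INR p); lra).
  (* Distance of the first Picard image from the reference line plus that of U^0. *)
  set (c1 := A * (B * (2 + B + C0)) + C0).
  assert (Hc1 : 0 <= c1).
  { unfold c1. assert (0 <= B * (2 + B + C0)) by nra. nra. }
  set (c2 := A * Lip + s * (Lip * W)). assert (Hc2 : 0 <= c2) by (unfold c2; nra).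
  (* Growth per sweep: [c2] collects the Lipschitz constant of [dg_map] and the old perturbation, 2
     s comes from [sum_absorb], and the summand 1 makes the powers of [q] monotone. *)
  set (q := 1 + 2 * s * c2).
  exists (2 * s * c1 * q ^ K), h0.
  assert (Hq : 1 <= q) by (unfold q; assert (0 <= s * c2) by nra; lra).
  split; [apply Rmult_le_pos; [nra|apply pow_le; lra]|]. split; [easy|].
  intros tn dt un U Hr HU0 Hsw.
  assert (Hr1 : in_range tn dt 1) by (apply in_range_le with h0; [lra|easy]).
  assert (Hr2 := Hr). destruct Hr2 as (Htn & Hdt & HT).
  set (E := Rabs (un - y tn)) in *. assert (HE : 0 <= E) by apply Rabs_pos.
  set (eta := dt + E) in *. assert (Heta : 0 <= eta) by (unfold eta; lra).
  specialize (Hsmall dt Hdt). fold s in Hsmall.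
  set (v0 := f tn (y tn)) in *.
  assert (Hmain : forall k, (k < K)%nat -> forall m, (m <= p)%nat ->
      Rabs (U (S k) m - U k m) <= 2 * s * c1 * q ^ k * (dt ^ S k * eta)).
  { induction k as [|k IH]; intros Hk.
    - intros m Hm. simpl pow. rewrite !Rmult_1_r.
      replace (2 * s * c1 * (dt * eta)) with (2 * s * (c1 * (dt * eta))) by ring.
      apply (sum_absorb p (fun m => Rabs (U 1%nat m - U 0%nat m)) (c1 * (dt * eta))
              (dt / 2 * (Lip * W))); auto.
      { intros; apply Rabs_pos. }
      clear m Hm. intros m Hm.
      replace (U 1%nat m - U 0%nat m) with
        ((U 1%nat m - dg_map tn dt un (U 0%nat) m)
         + ((dg_map tn dt un (U 0%nat) m - un - (node tn dt m - tn) * v0)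
            - (U 0%nat m - un - (node tn dt m - tn) * v0))) by ring.
      eapply Rle_trans; [apply Rabs_triang|].
      assert (H1 := Hsw 0%nat Hk m Hm). assert (H2 := HU0 m Hm).
      assert (H3 : Rabs (dg_map tn dt un (U 0%nat) m - un - (node tn dt m - tn) * v0)
                   <= A * (B * (2 + B + C0)) * (dt * eta)).
      { unfold dg_map.
        (* By [dg_row_sum] the line itself is the weighted sum of the constant slope [v0], so only
           slope differences remain. *)
        replace (un - _ - un - (node tn dt m - tn) * v0) with
          (- (dt / 2) * sum_f_R0 (fun j => Li m j * omega j *
             (f (tnode tau tn dt j) (U 0%nat j) - v0)) p).
        - rewrite Rabs_mult, Rabs_Ropp, (Rabs_right (dt / 2)) by lra.
          assert (Hb := weighted_row_le m (fun j => f (tnode tau tn dt j) (U 0%nat j) - v0)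
             (B * ((2 + B + C0) * eta)) Hm).
          cbv beta in Hb.
          assert (Hb' : Rabs (sum_f_R0 (fun j => Li m j * omega j *
             (f (tnode tau tn dt j) (U 0%nat j) - v0)) p) <= A * (B * ((2 + B + C0) * eta))).
          { apply Hb. intros j Hj. assert (Hn := node_range tn dt j ltac:(lra) Hj).
            destruct (Hs tn dt (node tn dt j) (U 0%nat j) Hr1 Hn) as (Hs1 & Hs2 & _).
            fold v0 in Hs1, Hs2. eapply Rle_trans; [exact Hs1|].
            apply Rmult_le_compat_l; [easy|].
            assert (Hd : Rabs (U 0%nat j - y tn) <= C0 * (dt * eta) + (E + dt * B)).
            { replace (U 0%nat j - y tn) with ((U 0%nat j - un - (node tn dt j - tn) * v0)
                + ((un - y tn) + (node tn dt j - tn) * v0)) by ring.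
              eapply Rle_trans; [apply Rabs_triang|]. apply Rplus_le_compat; [now apply HU0|].
              eapply Rle_trans; [apply Rabs_triang|]. apply Rplus_le_compat_l.
              rewrite Rabs_mult, (Rabs_right (node tn dt j - tn)) by lra.
              assert (0 <= Rabs v0) by apply Rabs_pos. nra. }
            assert (C0 * (dt * eta) <= C0 * eta) by (apply Rmult_le_compat_l; nra).
            assert (dt * B <= B * eta) by (unfold eta; nra).
            unfold eta in *. lra. }
          assert (0 <= A * (B * ((2 + B + C0) * eta))).
          { assert (0 <= (2 + B + C0) * eta) by nra.
            assert (0 <= B * ((2 + B + C0) * eta)) by nra. nra. }
          assert (0 <= Rabs (sum_f_R0 (fun j => Li m j * omega j *
             (f (tnode tau tn dt j) (U 0%nat j) - v0)) p)) by apply Rabs_pos.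
          nra.
        - rewrite (sum_eq _ (fun j => Li m j * omega j * f (tnode tau tn dt j) (U 0%nat j)
                     - v0 * (Li m j * omega j))) by (intros; ring).
          rewrite sum_minus_distr, sum_scal_l, dg_row_sum by easy.
          unfold node, tnode. field. }
      unfold Rminus at 2.
      assert (H4 := Rabs_triang (dg_map tn dt un (U 0%nat) m - un - (node tn dt m - tn) * v0)
                      (- (U 0%nat m - un - (node tn dt m - tn) * v0))).
      rewrite Rabs_Ropp in H4. unfold c1. lra.
    - intros m Hm. specialize (IH ltac:(lia)).
      set (D := 2 * s * c1 * q ^ k * (dt ^ S k * eta)) in *.
      assert (HD : 0 <= D) by (eapply Rle_trans; [apply Rabs_pos|apply (IH 0%nat); lia]).
      apply Rle_trans with (2 * s * (dt * c2 * D)).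
      + apply (sum_absorb p (fun m => Rabs (U (S (S k)) m - U (S k) m)) (dt * c2 * D)
              (dt / 2 * (Lip * W))); auto.
        { intros; apply Rabs_pos. }
        clear m Hm. intros m Hm.
        replace (U (S (S k)) m - U (S k) m) with
          ((U (S (S k)) m - dg_map tn dt un (U (S k)) m)
           + ((dg_map tn dt un (U (S k)) m - dg_map tn dt un (U k) m)
              + - (U (S k) m - dg_map tn dt un (U k) m))) by ring.
        eapply Rle_trans; [apply Rabs_triang|].
        assert (H1 := Hsw (S k) Hk m Hm). assert (H2 := Hsw k ltac:(lia) m Hm).
        assert (H3 := dg_map_lip tn dt un (U (S k)) (U k) D m ltac:(lra) Hm IH).
        assert (H4 := Rabs_triang (dg_map tn dt un (U (S k)) m - dg_map tn dt un (U k) m)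
                       (- (U (S k) m - dg_map tn dt un (U k) m))).
        rewrite Rabs_Ropp in H4.
        assert (H5 := sum_const_le p (fun l => Rabs (U (S k) l - U k l)) D IH). fold s in H5.
        assert (H6 : dt / 2 * (Lip * W) * sum_f_R0 (fun l => Rabs (U (S k) l - U k l)) p
                     <= dt / 2 * (Lip * W) * (s * D))
          by (apply Rmult_le_compat_l; [nra|easy]).
        assert (H7 : 0 <= dt * (A * Lip) * D) by (apply Rmult_le_pos; nra).
        assert (H8 : 0 <= dt * (s * (Lip * W)) * D)
          by (apply Rmult_le_pos; [apply Rmult_le_pos; nra|easy]).
        unfold c2.
        replace (dt * (A * Lip + s * (Lip * W)) * D) with
          (dt * (A * Lip) * D + dt * (s * (Lip * W)) * D) by ring.
        replace (dt / 2 * (Lip * W) * (s * D)) with (dt * (s * (Lip * W)) * D / 2) in H6 by field.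
        replace (dt / 2 * (A * Lip) * D) with (dt * (A * Lip) * D / 2) in H3 by field.
        lra.
      + unfold D. simpl pow. set (r := q ^ k). set (d := dt ^ k).
        assert (0 <= d) by (apply pow_le; lra). assert (0 <= r) by (apply pow_le; lra).
        replace (2 * s * c1 * (q * r) * (dt * (dt * d) * eta)) with
          (q * (2 * s * c1 * r * (dt * (dt * d) * eta))) by ring.
        replace (2 * s * (dt * c2 * (2 * s * c1 * r * (dt * d * eta)))) with
          (2 * s * c2 * (2 * s * c1 * r * (dt * (dt * d) * eta))) by ring.
        apply Rmult_le_compat_r; [|unfold q; lra].
        repeat apply Rmult_le_pos; lra. }
  intros k Hk m Hm. eapply Rle_trans; [now apply Hmain|].
  apply Rmult_le_compat_r; [apply Rmult_le_pos; [apply pow_le; lra|easy]|].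
  apply Rmult_le_compat_l; [nra|]. apply Rle_pow; [easy|lia].
Qed.

(** The defect of the last iterate is its perturbation minus the change of [dg_map] over the last
    sweep. Both are dt times the last increment, which gives the final power of dt. *)
Lemma sweep_defect C0 K :
  0 <= C0 ->
  exists C h0, 0 <= C /\ 0 < h0 <= 1 /\ forall tn dt un U, in_range tn dt h0 ->
    (forall m, (m <= p)%nat ->
      Rabs (U O m - un - (node tn dt m - tn) * f tn (y tn))
        <= C0 * (dt * (dt + Rabs (un - y tn)))) ->
    sweeps (S K) tn dt un U ->
    forall m, (m <= p)%nat ->
      Rabs (U (S K) m - dg_map tn dt un (U (S K)) m)
        <= C * (dt ^ (K + 2) * (dt + Rabs (un - y tn))).
Proof.
  intros HC0. destruct (sweep_increment C0 (S K) HC0) as (C & h0 & HC & Hh0 & Hinc).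
  assert (HW := W_nonneg). assert (HA := A_nonneg).
  assert (Hs0 := pos_INR (S p)). set (s := INR (S p)) in *.
  assert (HLW : 0 <= Lip * W) by nra. assert (HAL : 0 <= A * Lip) by nra.
  exists ((s * (Lip * W) + A * Lip) * C), h0.
  split; [apply Rmult_le_pos; nra|]. split; [easy|].
  intros tn dt un U Hr HU0 Hsw m Hm.
  assert (HD := Hinc tn dt un U Hr HU0 Hsw K ltac:(lia)). destruct Hr as (Htn & Hdt & HT).
  set (eta := dt + Rabs (un - y tn)) in *.
  assert (Heta : 0 <= eta) by (unfold eta; assert (H := Rabs_pos (un - y tn)); lra).
  set (D := C * (dt ^ S K * eta)) in *.
  assert (HD0 : 0 <= D) by (eapply Rle_trans; [apply Rabs_pos|apply (HD 0%nat); lia]).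
  replace (U (S K) m - dg_map tn dt un (U (S K)) m) with
    ((U (S K) m - dg_map tn dt un (U K) m)
     + - (dg_map tn dt un (U (S K)) m - dg_map tn dt un (U K) m)) by ring.
  eapply Rle_trans; [apply Rabs_triang|]. rewrite Rabs_Ropp.
  assert (H1 := Hsw K ltac:(lia) m Hm).
  assert (H2 := dg_map_lip tn dt un (U (S K)) (U K) D m ltac:(lra) Hm HD).
  assert (H5 := sum_const_le p (fun l => Rabs (U (S K) l - U K l)) D HD). fold s in H5.
  assert (H6 : dt / 2 * (Lip * W) * sum_f_R0 (fun l => Rabs (U (S K) l - U K l)) p
               <= dt / 2 * (Lip * W) * (s * D))
    by (apply Rmult_le_compat_l; [nra|easy]).
  replace ((s * (Lip * W) + A * Lip) * C * (dt ^ (K + 2) * eta)) with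
    (dt * (s * (Lip * W)) * D + dt * (A * Lip) * D).
  2: { unfold D. replace (K + 2)%nat with (S (S K)) by lia. simpl pow. ring. }
  assert (H7 : 0 <= dt * (A * Lip) * D) by (apply Rmult_le_pos; nra).
  assert (H8 : 0 <= dt * (s * (Lip * W)) * D)
    by (apply Rmult_le_pos; [apply Rmult_le_pos; nra|easy]).
  replace (dt / 2 * (Lip * W) * (s * D)) with (dt * (s * (Lip * W)) * D / 2) in H6 by field.
  replace (dt / 2 * (A * Lip) * D) with (dt * (A * Lip) * D / 2) in H2 by field.
  lra.
Qed.

(** * Stability and stage error *)

(** [U] and the exact nodal values satisfy the same equations up to [del] and [stage_residual]. The
    Lipschitz coupling of their difference is absorbed for small dt. *)
Lemma stage_error :
  exists C h0, 0 <= C /\ 0 < h0 <= 1 /\ forall tn dt un U del, in_range tn dt h0 ->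
    (forall m, (m <= p)%nat -> Rabs (U m - dg_map tn dt un U m) <= del) ->
    forall m, (m <= p)%nat ->
      Rabs (U m - y (node tn dt m)) <= C * (Rabs (un - y tn) + del + dt ^ (p + 2)).
Proof.
  destruct stage_residual as (C & HC & Hres). assert (HA := A_nonneg).
  assert (HAL : 0 <= A * Lip) by nra.
  destruct (small_step (A * Lip) HAL) as (h0 & Hh0 & Hsmall).
  assert (Hs0 := pos_INR (S p)).
  exists (2 * INR (S p) * (1 + C)), h0. split; [nra|]. split; [easy|].
  intros tn dt un U del Hr HU m Hm.
  assert (Hr1 : in_range tn dt 1) by (apply in_range_le with h0; [lra|easy]).
  destruct Hr as (Htn & Hdt & HT).
  set (E := Rabs (un - y tn)). assert (HE : 0 <= E) by apply Rabs_pos.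
  assert (Hdel : 0 <= del) by (eapply Rle_trans; [apply Rabs_pos|apply (HU 0%nat); lia]).
  assert (Hp2 : 0 <= dt ^ (p + 2)) by (apply pow_le; lra).
  set (e := fun m => Rabs (U m - y (node tn dt m))).
  apply Rle_trans with (2 * INR (S p) * (E + del + C * dt ^ (p + 2))).
  2: { rewrite (Rmult_assoc _ (1 + C)). apply Rmult_le_compat_l; nra. }
  apply (sum_absorb p e (E + del + C * dt ^ (p + 2)) (dt / 2 * (A * Lip))); auto.
  { intros; apply Rabs_pos. }
  clear m Hm. intros m Hm. unfold e at 1.
  assert (He : forall j, (j <= p)%nat -> Rabs (U j - y (node tn dt j)) <= sum_f_R0 e p)
    by (intros j Hj; apply (sum_term_le p e j); [intros; apply Rabs_pos|easy]).
  assert (H1 := Hres tn dt m Hr1 Hm).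
  assert (H2 := dg_map_lip tn dt un U (fun j => y (node tn dt j)) (sum_f_R0 e p) m
                  ltac:(lra) Hm He).
  assert (H3 := HU m Hm).
  set (r := y (node tn dt m) - y tn + _) in H1.
  replace (U m - y (node tn dt m)) with
    ((U m - dg_map tn dt un U m) +
     ((dg_map tn dt un U m - dg_map tn dt un (fun j => y (node tn dt j)) m)
      + ((un - y tn) + - r))).
  2: { unfold r, dg_map. fold (node tn dt). ring. }
  assert (T1 := Rabs_triang (U m - dg_map tn dt un U m)
     ((dg_map tn dt un U m - dg_map tn dt un (fun j => y (node tn dt j)) m)
      + ((un - y tn) + - r))).
  assert (T2 := Rabs_triang
     (dg_map tn dt un U m - dg_map tn dt un (fun j => y (node tn dt j)) m)
      ((un - y tn) + - r)).
  assert (T3 := Rabs_triang (un - y tn) (- r)). rewrite Rabs_Ropp in T3. fold E in T3.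
  lra.
Qed.

(** Feeding [stage_error] back into the Lipschitz term, which carries a factor dt, reduces the
    coefficient of the old error to 1 + O(dt), as Gronwall requires. *)
Lemma stage_error_sharp :
  exists C h0, 0 <= C /\ 0 < h0 <= 1 /\ forall tn dt un U del, in_range tn dt h0 ->
    (forall m, (m <= p)%nat -> Rabs (U m - dg_map tn dt un U m) <= del) ->
    forall m, (m <= p)%nat ->
      Rabs (U m - y (node tn dt m))
        <= Rabs (un - y tn) + C * (dt * Rabs (un - y tn) + del + dt ^ (p + 2)).
Proof.
  destruct stage_residual as (C & HC & Hres). assert (HA := A_nonneg).
  assert (HAL : 0 <= A * Lip) by nra.
  destruct stage_error as (Cs & h0 & HCs & Hh0 & Hst).
  exists (1 + C + A * Lip * Cs), h0. split; [nra|]. split; [easy|].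
  intros tn dt un U del Hr HU m Hm. assert (He := Hst tn dt un U del Hr HU).
  assert (Hr1 : in_range tn dt 1) by (apply in_range_le with h0; [lra|easy]).
  destruct Hr as (Htn & Hdt & HT).
  assert (H1 := Hres tn dt m Hr1 Hm).
  set (E := Rabs (un - y tn)) in *. assert (HE : 0 <= E) by apply Rabs_pos.
  assert (Hdel : 0 <= del) by (eapply Rle_trans; [apply Rabs_pos|apply (HU 0%nat); lia]).
  assert (Hp2 : 0 <= dt ^ (p + 2)) by (apply pow_le; lra).
  assert (H2 := dg_map_lip tn dt un U (fun j => y (node tn dt j)) _ m ltac:(lra) Hm He).
  assert (H3 := HU m Hm).
  set (r := y (node tn dt m) - y tn + _) in H1.
  replace (U m - y (node tn dt m)) with
    ((U m - dg_map tn dt un U m) +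
     ((dg_map tn dt un U m - dg_map tn dt un (fun j => y (node tn dt j)) m)
      + ((un - y tn) + - r))).
  2: { unfold r, dg_map. fold (node tn dt). ring. }
  assert (T1 := Rabs_triang (U m - dg_map tn dt un U m)
     ((dg_map tn dt un U m - dg_map tn dt un (fun j => y (node tn dt j)) m)
      + ((un - y tn) + - r))).
  assert (T2 := Rabs_triang
     (dg_map tn dt un U m - dg_map tn dt un (fun j => y (node tn dt j)) m)
      ((un - y tn) + - r)).
  assert (T3 := Rabs_triang (un - y tn) (- r)). rewrite Rabs_Ropp in T3. fold E in T3.
  set (d := dt ^ (p + 2)) in *.
  assert (HQ : 0 <= A * Lip * Cs) by nra.
  assert (H4 : dt / 2 * (A * Lip) * (Cs * (E + del + d)) <= A * Lip * Cs * (dt * E + del + d)).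
  { replace (dt / 2 * (A * Lip) * (Cs * (E + del + d))) with
      (A * Lip * Cs * (dt / 2 * (E + del + d))) by ring.
    apply Rmult_le_compat_l; [easy|]. nra. }
  assert (H5 : 0 <= dt * E) by nra.
  assert (H6 : 0 <= C * (dt * E + del)) by nra. nra.
Qed.

(** * Superconvergence at the end point by duality *)

(* Contracting the equations of [dg_map] with the nodal values of a test
   polynomial [P]: quadrature exactness turns [P^T L] into a derivative. *)
Lemma dg_test_identity tn dt un U P P' :
  polyd p P -> (forall x, is_derive P x (P' x)) ->
  P (tn + dt) * U p =
    dt / 2 * sum_f_R0 (fun m => omega m * (P' (node tn dt m) * U m)) p
    + dt / 2 * sum_f_R0 (fun j => omega j * (P (node tn dt j) * f (node tn dt j) (U j))) p
    + P tn * un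
    - (dt / 2 * sum_f_R0 (fun m => omega m * (P' (node tn dt m)
                  * (U m - dg_map tn dt un U m))) p
       - P (tn + dt) * (U p - dg_map tn dt un U p)).
Proof.
  intros HP HD.
  set (Q := fun x => P (dt / 2 * x + (tn + dt / 2))).
  set (Q' := fun x => dt / 2 * P' (dt / 2 * x + (tn + dt / 2))).
  assert (HQ : polyd p Q) by (now apply polyd_affine).
  assert (HQD : forall x, is_derive Q x (Q' x)).
  { intros x. unfold Q'. evar_last.
    - apply (is_derive_comp P (fun x => dt / 2 * x + (tn + dt / 2)) x).
      + apply HD.
      + auto_derive; [easy|reflexivity].
    - unfold scal; simpl; unfold mult; simpl. ring. }
  assert (Hnode : forall j, dt / 2 * tau j + (tn + dt / 2) = node tn dt j)
    by (intros; unfold node, tnode; field).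
  assert (HQn : forall j, Q (tau j) = P (node tn dt j)) by (intros; unfold Q; now rewrite Hnode).
  assert (HQ'n : forall j, Q' (tau j) = dt / 2 * P' (node tn dt j))
    by (intros; unfold Q'; now rewrite Hnode).
  assert (HQ1 : Q 1 = P (tn + dt)) by (unfold Q; f_equal; field).
  assert (HQm1 : Q (-1) = P tn) by (unfold Q; f_equal; field).
  (* [q] is the row vector P^T L on the reference interval. Against constants it gives - P(tn) by
     quadrature ([Hq1]); against L^-1 it gives back the nodal values of [P] ([HqL]). *)
  set (q := fun m => omega m * Q' (tau m) - Q 1 * kdelta m p).
  assert (Hq : forall m, (m <= p)%nat -> q m = sum_f_R0 (fun i => Q (tau i) * Lm i m) p).
  { intros m Hm. unfold q. symmetry. now apply (radau_test_identity p tau omega Lm). }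
  assert (Hqsum : forall X : nat -> R, sum_f_R0 (fun m => q m * X m) p =
     dt / 2 * sum_f_R0 (fun m => omega m * (P' (node tn dt m) * X m)) p - P (tn + dt) * X p).
  { intros X. rewrite (sum_eq _ (fun m => dt / 2 * (omega m * (P' (node tn dt m) * X m))
        - P (tn + dt) * (kdelta p m * X m))).
    - now rewrite sum_minus_distr, !sum_scal_l, sum_kdelta.
    - intros m Hm. unfold q. rewrite HQ'n, HQ1, (kdelta_sym m p). ring. }
  assert (Hq1 : sum_f_R0 (fun m => q m * un) p = - P tn * un).
  { rewrite (sum_eq _ (fun m => un * (omega m * Q' (tau m) - Q 1 * (kdelta p m * 1))))
      by (intros; unfold q; rewrite (kdelta_sym p); ring).
    rewrite sum_scal_l, sum_minus_distr, sum_scal_l, sum_kdelta by easy.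
    rewrite (radau_derive p tau omega p Q Q' Hradau HQ ltac:(lia) HQD), HQm1. ring. }
  assert (HqL : sum_f_R0 (fun m => q m *
       sum_f_R0 (fun j => Li m j * omega j * f (node tn dt j) (U j)) p) p
     = sum_f_R0 (fun j => omega j * (P (node tn dt j) * f (node tn dt j) (U j))) p).
  { rewrite (sum_eq _ (fun m => sum_f_R0 (fun j => q m * Li m j *
        (omega j * f (node tn dt j) (U j))) p)).
    2: { intros m Hm. rewrite <- sum_scal_l. apply sum_eq. intros; ring. }
    rewrite sum_swap. apply sum_eq. intros j Hj.
    rewrite (sum_eq _ (fun m => (omega j * f (node tn dt j) (U j)) * (q m * Li m j)))
      by (intros; ring).
    rewrite sum_scal_l.
    replace (sum_f_R0 (fun m => q m * Li m j) p) with (P (node tn dt j)); [ring|].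
    rewrite (sum_eq _ (fun m => sum_f_R0 (fun i => Q (tau i) * (Lm i m * Li m j)) p)).
    2: { intros m Hm. rewrite Hq, Rmult_comm, <- sum_scal_l by easy.
         apply sum_eq. intros; ring. }
    rewrite sum_swap.
    rewrite (sum_eq _ (fun i => kdelta j i * Q (tau i))).
    - now rewrite sum_kdelta, HQn.
    - intros i Hi. rewrite sum_scal_l, (proj1 (HLi i j Hi Hj)), (kdelta_sym i j). ring. }
  assert (HU : sum_f_R0 (fun m => q m * U m) p =
    sum_f_R0 (fun m => q m * un) p
    - dt / 2 * sum_f_R0 (fun m => q m *
       sum_f_R0 (fun j => Li m j * omega j * f (node tn dt j) (U j)) p) p
    + sum_f_R0 (fun m => q m * (U m - dg_map tn dt un U m)) p).
  { rewrite <- sum_scal_l, <- sum_minus_distr, <- sum_plus. apply sum_eq.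
    intros m Hm. unfold dg_map. fold (node tn dt). ring. }
  rewrite Hq1, HqL, !Hqsum in HU. lra.
Qed.

(* Expanding the exact solution only to degree [2 p + 1 - k] makes the product
   with the monomial of degree [k] exactly integrable, and loses nothing. *)
Lemma quadrature_monomial :
  exists C, 0 <= C /\ forall tn dt k, in_range tn dt 1 -> (k <= p)%nat ->
    Rabs (dt / 2 * sum_f_R0 (fun j => omega j *
            (INR k * (node tn dt j - (tn + dt)) ^ pred k * y (node tn dt j)
             + (node tn dt j - (tn + dt)) ^ k * f (node tn dt j) (y (node tn dt j)))) p
          - ((tn + dt - (tn + dt)) ^ k * y (tn + dt) - (tn - (tn + dt)) ^ k * y tn))
      <= C * dt ^ (2 * p + 2).
Proof.
  destruct exact_jet as (w & M & H0 & H1 & Hj & HM & Hb).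
  assert (HW := W_nonneg). assert (Hp := pos_INR p).
  exists (M * (W * (INR p + 1) + 1)). split; [apply Rmult_le_pos; nra|].
  intros tn dt k (Htn & Hdt & HT) Hk.
  set (t1 := tn + dt). set (d := (2 * p + 1 - k)%nat).
  set (Sp := tay w t1 d). set (Sp' := dtay w t1 d).
  assert (Habs : forall x, tn <= x <= t1 -> Rabs (x - t1) <= dt)
    by (intros; apply Rabs_le; unfold t1 in *; lra).
  assert (Hpow : forall l x, tn <= x <= t1 -> Rabs (x - t1) ^ l <= dt ^ l).
  { intros l x Hx. apply pow_incr. split; [apply Rabs_pos|now apply Habs]. }
  assert (HR : forall x, tn <= x <= t1 -> Rabs (y x - Sp x) <= M * dt ^ S d).
  { intros x Hx. rewrite <- H0.
    eapply Rle_trans; [apply (taylor_bound T d w M t1 x)|].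
    - apply jet_le with (2 * p + 2)%nat; [lia|easy].
    - intros; apply Hb; [lia|easy].
    - unfold t1; lra.
    - unfold t1 in *; lra.
    - apply Rmult_le_compat_l; [easy|now apply Hpow]. }
  assert (HR' : forall x, tn <= x <= t1 -> Rabs (f x (y x) - Sp' x) <= M * dt ^ d).
  { intros x Hx. replace (f x (y x)) with (w 1%nat x) by now rewrite H1.
    eapply Rle_trans; [apply (taylor_derive_bound T d w M t1 x)|].
    - apply jet_le with (2 * p + 2)%nat; [lia|easy].
    - intros; apply Hb; [lia|easy].
    - unfold t1; lra.
    - unfold t1 in *; lra.
    - apply Rmult_le_compat_l; [easy|now apply Hpow]. }
  set (phi := fun x => dt / 2 * x + (tn + dt / 2)).
  assert (Hnode : forall j, phi (tau j) = node tn dt j)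
    by (intros; unfold phi, node, tnode; field).
  assert (Hex := radau_derive p tau omega (k + d) (fun x => (phi x - t1) ^ k * Sp (phi x))
    (fun x => dt / 2 * (INR k * (phi x - t1) ^ pred k * Sp (phi x)
                        + (phi x - t1) ^ k * Sp' (phi x))) Hradau).
  cbv beta in Hex.
  replace (phi 1) with t1 in Hex by (unfold phi, t1; field).
  replace (phi (-1)) with tn in Hex by (unfold phi; field).
  rewrite (sum_eq _ (fun j => dt / 2 * (omega j *
      (INR k * (node tn dt j - t1) ^ pred k * Sp (node tn dt j)
       + (node tn dt j - t1) ^ k * Sp' (node tn dt j))))) in Hex
    by (intros; rewrite Hnode; ring).
  rewrite sum_scal_l in Hex.
  assert (Hex' : dt / 2 * sum_f_R0 (fun j => omega j *
      (INR k * (node tn dt j - t1) ^ pred k * Sp (node tn dt j)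
       + (node tn dt j - t1) ^ k * Sp' (node tn dt j))) p
     = (t1 - t1) ^ k * Sp t1 - (tn - t1) ^ k * Sp tn).
  { apply Hex; [|lia|].
    - apply (polyd_affine (k + d) (fun x => (x - t1) ^ k * Sp x)).
      apply polyd_mult; [apply polyd_pow|apply tay_polyd].
    - intros x. evar_last.
      + apply (is_derive_comp (fun x => (x - t1) ^ k * Sp x) phi x).
        * apply (is_derive_mult (fun x => (x - t1) ^ k) Sp (phi x)).
          -- auto_derive; [easy|reflexivity].
          -- apply is_derive_tay.
          -- intros; apply Rmult_comm.
        * unfold phi. auto_derive; [easy|reflexivity].
      + unfold scal, plus, mult; simpl; unfold mult; simpl. unfold Sp', Rminus. ring. }
  clear Hex.
  (* Expansion about the right end leaves no remainder there; only the boundary term at [tn]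
     contributes one. *)
  assert (HS1 : Sp t1 = y t1) by (unfold Sp; now rewrite tay_center, H0).
  set (rem := fun j => INR k * (node tn dt j - t1) ^ pred k * (y (node tn dt j) - Sp (node tn dt j))
     + (node tn dt j - t1) ^ k * (f (node tn dt j) (y (node tn dt j)) - Sp' (node tn dt j))).
  replace (_ - _) with (dt / 2 * sum_f_R0 (fun j => omega j * rem j) p
      + (tn - t1) ^ k * (y tn - Sp tn)).
  2: { rewrite (sum_eq (fun j => omega j * (INR k * (node tn dt j - t1) ^ pred k
            * y (node tn dt j) + _))
         (fun j => omega j * (INR k * (node tn dt j - t1) ^ pred k * Sp (node tn dt j)
            + (node tn dt j - t1) ^ k * Sp' (node tn dt j)) + omega j * rem j))
         by (intros; unfold rem; ring).
       rewrite sum_plus, Rmult_plus_distr_l, Hex', HS1. ring. }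
  (* Differentiating the monomial costs one power of dt, which the step factor in front of the
     quadrature sum gives back. For k = 0 the truncated exponent is harmless because of the factor
     [INR 0]. *)
  assert (Hdk : forall x, tn <= x <= t1 ->
      dt * Rabs (INR k * (x - t1) ^ pred k) <= INR p * dt ^ k).
  { intros x Hx. rewrite Rabs_mult, (Rabs_right (INR k)) by (apply Rle_ge, pos_INR).
    destruct k as [|k']; [simpl; lra|].
    rewrite <- RPow_abs. simpl pred. simpl (dt ^ S k').
    assert (B1 := Hpow k' x Hx).
    assert (B2 : INR (S k') <= INR p) by (apply le_INR; lia).
    assert (B3 : 0 <= INR (S k')) by apply pos_INR.
    assert (B4 : 0 <= Rabs (x - t1) ^ k') by (apply pow_le, Rabs_pos).
    replace (INR p * (dt * dt ^ k')) with (dt * (INR p * dt ^ k')) by ring.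
    apply Rmult_le_compat_l; [lra|]. now apply Rmult_le_compat. }
  assert (Htot : dt ^ (2 * p + 2) = dt ^ k * (dt * dt ^ d)).
  { replace (2 * p + 2)%nat with (k + S d)%nat by lia. now rewrite pow_add. }
  assert (Hrem : forall j, (j <= p)%nat ->
     Rabs (dt * rem j) <= M * (INR p + 1) * dt ^ (2 * p + 2)).
  { intros j Hjp. assert (Hn := node_range tn dt j ltac:(lra) Hjp). fold t1 in Hn.
    unfold rem. set (x := node tn dt j) in *.
    assert (B1 := Hdk x Hn). assert (B2 := HR x Hn). assert (B3 := HR' x Hn).
    assert (B4 := Hpow k x Hn). rewrite RPow_abs in B4.
    assert (C1 : dt * Rabs (INR k * (x - t1) ^ pred k) * Rabs (y x - Sp x)
        <= INR p * dt ^ k * (M * dt ^ S d)).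
    { apply Rmult_le_compat; try easy.
      - apply Rmult_le_pos; [lra|apply Rabs_pos].
      - apply Rabs_pos. }
    assert (C2 : Rabs ((x - t1) ^ k) * Rabs (f x (y x) - Sp' x) <= dt ^ k * (M * dt ^ d))
      by (apply Rmult_le_compat; try easy; apply Rabs_pos).
    rewrite Rabs_mult, (Rabs_right dt) by lra.
    assert (C3 := Rabs_triang (INR k * (x - t1) ^ pred k * (y x - Sp x))
       ((x - t1) ^ k * (f x (y x) - Sp' x))).
    rewrite !(Rabs_mult _ (_ - _)) in C3.
    assert (C4 : dt * Rabs (INR k * (x - t1) ^ pred k * (y x - Sp x)
          + (x - t1) ^ k * (f x (y x) - Sp' x))
       <= dt * (Rabs (INR k * (x - t1) ^ pred k) * Rabs (y x - Sp x)
          + Rabs ((x - t1) ^ k) * Rabs (f x (y x) - Sp' x)))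
      by (apply Rmult_le_compat_l; lra).
    assert (C5 : dt * (Rabs ((x - t1) ^ k) * Rabs (f x (y x) - Sp' x))
                 <= dt * (dt ^ k * (M * dt ^ d))) by (apply Rmult_le_compat_l; lra).
    rewrite Htot. simpl (dt ^ S d) in C1.
    replace (M * (INR p + 1) * (dt ^ k * (dt * dt ^ d))) with
      (INR p * dt ^ k * (M * (dt * dt ^ d)) + dt * (dt ^ k * (M * dt ^ d))) by ring.
    lra. }
  assert (Hsum := sum_weighted_le p omega (fun j => dt * rem j) _ Hrem). fold W in Hsum.
  rewrite (sum_eq _ (fun j => dt * (omega j * rem j))), sum_scal_l in Hsum by (intros; ring).
  replace (dt / 2 * sum_f_R0 (fun j => omega j * rem j) p) with
    (/ 2 * (dt * sum_f_R0 (fun j => omega j * rem j) p)) by field.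
  assert (Hend : Rabs ((tn - t1) ^ k * (y tn - Sp tn)) <= M * dt ^ (2 * p + 2)).
  { rewrite Rabs_mult, <- RPow_abs, Htot.
    replace (M * (dt ^ k * (dt * dt ^ d))) with (dt ^ k * (M * dt ^ S d)) by (simpl; ring).
    apply Rmult_le_compat; [apply pow_le, Rabs_pos|apply Rabs_pos| |].
    - apply Hpow. unfold t1; lra.
    - apply HR. unfold t1; lra. }
  eapply Rle_trans; [apply Rabs_triang|].
  rewrite Rabs_mult, (Rabs_right (/ 2)) by lra.
  assert (0 <= W * (M * (INR p + 1) * dt ^ (2 * p + 2))).
  { eapply Rle_trans; [|exact Hsum]. apply Rabs_pos. }
  replace (M * (W * (INR p + 1) + 1) * dt ^ (2 * p + 2)) with
    (W * (M * (INR p + 1) * dt ^ (2 * p + 2)) + M * dt ^ (2 * p + 2)) by ring.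
  lra.
Qed.

(** The quadrature error is linear in the test polynomial, so the monomial estimates add up;
    dividing by a factorial does not enlarge the coefficients. *)
Lemma quadrature_taylor wz Mz :
  0 <= Mz ->
  exists C, 0 <= C /\ forall tn dt, in_range tn dt 1 ->
    (forall k, (k <= p)%nat -> Rabs (wz k (tn + dt)) <= Mz) ->
    Rabs (dt / 2 * sum_f_R0 (fun j => omega j *
            (dtay wz (tn + dt) p (node tn dt j) * y (node tn dt j)
             + tay wz (tn + dt) p (node tn dt j) * f (node tn dt j) (y (node tn dt j)))) p
          - (tay wz (tn + dt) p (tn + dt) * y (tn + dt) - tay wz (tn + dt) p tn * y tn))
      <= C * dt ^ (2 * p + 2).
Proof.
  intros HMz. destruct quadrature_monomial as (C & HC & Hmono).
  assert (Hs0 := pos_INR (S p)).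
  exists (INR (S p) * (Mz * C)). split; [apply Rmult_le_pos; nra|].
  intros tn dt Hr Hwz. set (t1 := tn + dt) in *.
  set (c := fun k => wz k t1 / INR (fact k)).
  set (qe := fun k => dt / 2 * sum_f_R0 (fun j => omega j *
            (INR k * (node tn dt j - t1) ^ pred k * y (node tn dt j)
             + (node tn dt j - t1) ^ k * f (node tn dt j) (y (node tn dt j)))) p
          - ((t1 - t1) ^ k * y t1 - (tn - t1) ^ k * y tn)).
  replace (_ - _) with (sum_f_R0 (fun k => c k * qe k) p).
  - rewrite Rmult_assoc.
    eapply Rle_trans; [apply Rsum_abs|]. apply sum_const_le. intros k Hk.
    rewrite Rabs_mult, Rmult_assoc. apply Rmult_le_compat; try apply Rabs_pos.
    + unfold c, Rdiv. rewrite Rabs_mult, <- (Rmult_1_r Mz).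
      assert (Hf1 : 1 <= INR (fact k)).
      { replace 1 with (INR 1) by reflexivity. apply le_INR. assert (H := lt_O_fact k). lia. }
      apply Rmult_le_compat; try apply Rabs_pos; [now apply Hwz|].
      rewrite Rabs_right.
      * rewrite <- Rinv_1. apply Rinv_le_contravar; lra.
      * apply Rle_ge, Rlt_le, Rinv_0_lt_compat; lra.
    + now apply Hmono.
  - unfold qe.
    rewrite (sum_eq _ (fun k => dt / 2 * sum_f_R0 (fun j => c k * (omega j *
            (INR k * (node tn dt j - t1) ^ pred k * y (node tn dt j)
             + (node tn dt j - t1) ^ k * f (node tn dt j) (y (node tn dt j))))) p
          - (y t1 * (c k * (t1 - t1) ^ k) - y tn * (c k * (tn - t1) ^ k)))).
    2: { intros k Hk. rewrite sum_scal_l. ring. }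
    rewrite !sum_minus_distr, !sum_scal_l, sum_swap.
    unfold tay. fold c.
    rewrite (Rmult_comm (y t1)), (Rmult_comm (y tn)).
    f_equal. f_equal. apply sum_eq. intros j Hj. unfold dtay.
    rewrite (sum_eq _ (fun k => omega j * y (node tn dt j) *
        (wz k t1 / INR (fact k) * (INR k * (node tn dt j - t1) ^ pred k))
        + omega j * f (node tn dt j) (y (node tn dt j)) *
        (wz k t1 / INR (fact k) * (node tn dt j - t1) ^ k)))
      by (intros; unfold c; ring).
    rewrite sum_plus, !sum_scal_l. ring.
Qed.

(** The linear bound holds for every [x] because [f] is globally Lipschitz. The quadratic one needs
    a bound on the second derivative, which compactness provides on the tube of radius 1 around the
    exact solution; p >= 1 guarantees that this derivative exists. *)
Lemma linearization :
  (1 <= p)%nat ->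
  exists fu C, 0 <= C /\ Ck (2 * p) fu /\
    forall t x, 0 <= t <= T ->
      let r := f t x - f t (y t) - fu t (y t) * (x - y t) in
      Rabs r <= C * Rabs (x - y t) /\
      (Rabs (x - y t) <= 1 -> Rabs r <= C * Rabs (x - y t) ^ 2).
Proof.
  intros Hp. assert (Hf' := Hf).
  replace (2 * p + 1)%nat with (S (2 * p)) in Hf' by lia.
  destruct Hf' as (_ & ft & fu & _ & Hfu & _ & Cfu).
  assert (Cfu' := Cfu).
  replace (2 * p)%nat with (S (2 * p - 1)) in Cfu' by lia.
  destruct Cfu' as (Jfu & fut & fuu & _ & Hfuu & _ & Cfuu).
  destruct (continuous_bounded 0 T y Hyc) as (My & HMy & Hyb).
  destruct (jcont_bounded fuu 0 T (- (My + 1)) (My + 1) (Ck_jcont _ _ Cfuu))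
    as (M2 & HM2 & Hb2).
  destruct (continuous_bounded 0 T (fun t => fu t (y t))) as (Ma & HMa & Hab).
  { intros; now apply jcont_curve_continuous. }
  exists fu, (Lip + Ma + M2). split; [lra|]. split; [easy|].
  intros t x Ht r. set (e := Rabs (x - y t)). assert (He : 0 <= e) by apply Rabs_pos.
  assert (Hcont : forall g g' z, (forall v, derivable_pt_lim (fun s => g t s) v (g' v)) ->
      continuity_pt (fun s : R => g t s : R) z).
  { intros g g' z Hg. apply derivable_continuous_pt. exists (g' z). apply Hg. }
  split.
  - unfold r, Rminus at 1. eapply Rle_trans; [apply Rabs_triang|].
    rewrite Rabs_Ropp, Rabs_mult. fold e.
    assert (H1 := HLip t x (y t)). fold e in H1.
    assert (H2 := Hab t Ht). nra.
  - intros He1.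
    assert (Hseg : forall c, Rmin (y t) x <= c <= Rmax (y t) x -> Rabs (c - y t) <= e).
    { intros c. unfold e, Rmin, Rmax, Rabs. destruct (Rle_dec (y t) x);
        destruct (Rcase_abs (c - y t)); destruct (Rcase_abs (x - y t)); lra. }
    destruct (MVT_gen (fun s => f t s) (y t) x (fun s => fu t s)) as (c & Hc & Heq).
    { intros; apply is_derive_Reals, Hfu. }
    { intros z _. apply (Hcont f (fun v => fu t v)). apply Hfu. }
    destruct (MVT_gen (fun s => fu t s) (y t) c (fun s => fuu t s)) as (d & Hd & Heq2).
    { intros; apply is_derive_Reals, Hfuu. }
    { intros z _. apply (Hcont fu (fun v => fuu t v)). apply Hfuu. }
    assert (Hce := Hseg c Hc).
    assert (Hde : Rabs (d - y t) <= e).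
    { apply Rle_trans with (Rabs (c - y t)); [|easy].
      revert Hd. unfold Rmin, Rmax, Rabs. destruct (Rle_dec (y t) c);
        destruct (Rcase_abs (d - y t)); destruct (Rcase_abs (c - y t)); lra. }
    replace r with (fuu t d * (c - y t) * (x - y t)).
    2: { unfold r. rewrite Heq, <- Heq2. ring. }
    rewrite !Rabs_mult. fold e.
    assert (H2 : Rabs (fuu t d) <= M2).
    { apply Hb2; [easy|].
      assert (Hyt := Hyb t Ht). apply Rabs_le_between in Hyt.
      assert (Hd1 : Rabs (d - y t) <= 1) by lra. apply Rabs_le_between in Hd1. lra. }
    assert (0 <= Rabs (c - y t)) by apply Rabs_pos.
    assert (0 <= Rabs (fuu t d)) by apply Rabs_pos.
    assert (Rabs (fuu t d) * Rabs (c - y t) <= M2 * e) by (now apply Rmult_le_compat).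
    simpl. rewrite Rmult_1_r.
    assert (0 <= e * e) by nra.
    assert (Rabs (fuu t d) * Rabs (c - y t) * e <= M2 * e * e) by nra. nra.
Qed.

(* The error is tested with the Taylor polynomial [P] of the dual solution
   [z' = - f_u(t, y) z], so that only products of two stage-order quantities and
   the quadrature error of [(P y)'] remain. *)
Lemma superconvergence :
  (1 <= p)%nat ->
  exists C h0, 0 <= C /\ 0 < h0 <= 1 /\ forall tn dt un U del, in_range tn dt h0 ->
    (forall m, (m <= p)%nat -> Rabs (U m - dg_map tn dt un U m) <= del) ->
    Rabs (U p - y (tn + dt))
      <= Rabs (un - y tn) + C * (dt * Rabs (un - y tn) + del + dt ^ (2 * p + 2)).
Proof.
  intros Hp.
  destruct (linearization Hp) as (fu & Cn & HCn & Cfu & Hlin).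
  set (a := fun t => fu t (y t)).
  assert (Ha : smooth T (2 * p) a).
  { apply (smooth_curve T (2 * p) f y fu); auto. apply Ck_le with (2 * p + 1)%nat; [lia|easy]. }
  assert (Hac : forall x, continuous a x) by (intros; now apply (smooth_continuous T (2 * p))).
  destruct (continuous_bounded 0 T a Hac) as (Ma & HMa & Hab).
  destruct (dual_solution a Hac) as (z & HzD & Hzpos).
  assert (Hzc : forall x, continuous z x).
  { intros x. apply (ex_derive_continuous z x). now exists (- a x * z x). }
  destruct (smooth_jet_derive T (2 * p) z (fun x => - a x * z x)) as (wz & Hw0 & Hw1 & Hwz); auto.
  { apply smooth_mult; [now apply smooth_opp|].
    apply smooth_pred. now apply dual_smooth with a. }
  destruct (jet_bounded T _ wz Hwz) as (Mz & HMz & Hzb).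
  (* A single dual solution on all of [0, T] serves every step, so the bounds on [z] and [/ z] are
     uniform in the step. *)
  destruct (continuous_bounded 0 T (fun x => / z x)) as (Mi & HMi & Hib).
  { intros x. apply (continuous_comp z Rinv x); [easy|].
    apply continuity_pt_filterlim. apply derivable_continuous_pt.
    apply derivable_pt_inv; [assert (H := Hzpos x); lra|apply derivable_pt_id]. }
  destruct (quadrature_taylor wz Mz HMz) as (Cq & HCq & Hquad).
  destruct stage_error as (Cs & h1 & HCs & Hh1 & Hst).
  assert (HW := W_nonneg).
  (* Ensures 2 * Cs * dt <= 1, hence a stage error at most 1 whenever dt^(p+2) dominates it. *)
  set (h0 := Rmin h1 (/ (2 * Cs + 1))).
  assert (Hi : 0 < / (2 * Cs + 1)) by (apply Rinv_0_lt_compat; lra).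
  set (k1 := Mz * (1 + Ma) * Cs).
  set (k2 := 2 * Mz * (Cn * (2 * Cs + 4 * Cs ^ 2))).
  set (k3 := Mz * (1 + Ma)).
  (* One summand for each term of [Hmain]: dual residual, nonlinear remainder, drift of the weight
     of the old error, defect at the nodes, defect at the end point, quadrature error. *)
  set (Ct := W * k1 + W * k2 + 2 * Mz + W * k3 + Mz + Cq).
  assert (Hk3 : 0 <= k3) by (unfold k3; nra).
  assert (Hk1 : 0 <= k1) by (unfold k1; fold k3; nra).
  assert (HCs2 : 0 <= 2 * Cs + 4 * Cs ^ 2) by nra.
  assert (Hk2' : 0 <= Cn * (2 * Cs + 4 * Cs ^ 2)) by nra.
  assert (Hk2 : 0 <= k2) by (unfold k2; nra).
  assert (HWk1 : 0 <= W * k1) by nra. assert (HWk2 : 0 <= W * k2) by nra.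
  assert (HWk3 : 0 <= W * k3) by nra.
  assert (HCt : 0 <= Ct) by (unfold Ct; lra).
  exists (Mi * Ct), h0. split; [nra|].
  split; [split; [apply Rmin_glb_lt; lra|apply Rle_trans with h1; [apply Rmin_l|lra]]|].
  intros tn dt un U del Hr HU.
  assert (Hrs : in_range tn dt h1) by (apply in_range_le with h0; [apply Rmin_l|easy]).
  assert (Hr1 : in_range tn dt 1) by (apply in_range_le with h1; [lra|easy]).
  assert (Hst' := Hst tn dt un U del Hrs HU).
  destruct Hr as (Htn & Hdt & HT).
  assert (HdtC : 2 * Cs * dt <= 1).
  { assert (Hh2 : h0 <= / (2 * Cs + 1)) by apply Rmin_r.
    assert (Hm : (2 * Cs + 1) * dt <= (2 * Cs + 1) * / (2 * Cs + 1))
      by (apply Rmult_le_compat_l; lra).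
    rewrite Rinv_r in Hm by lra. nra. }
  assert (Hdt1 : dt <= 1) by (destruct Hr1; lra).
  set (t1 := tn + dt) in *.
  set (E := Rabs (un - y tn)) in *. assert (HE : 0 <= E) by apply Rabs_pos.
  assert (Hdel : 0 <= del) by (eapply Rle_trans; [apply Rabs_pos|apply (HU 0%nat); lia]).
  set (P := tay wz t1 p). set (P' := dtay wz t1 p).
  assert (Hpow1 : forall k, 0 <= dt ^ k <= 1)
    by (intros k; split; [apply pow_le; lra|rewrite <- (pow1 k); apply pow_incr; lra]).
  assert (Hpowabs : forall k x, tn <= x <= t1 -> Rabs (x - t1) ^ k <= dt ^ k).
  { intros k x Hx. apply pow_incr. split; [apply Rabs_pos|].
    apply Rabs_le. unfold t1 in *; lra. }
  assert (HPz : forall x, tn <= x <= t1 -> Rabs (z x - P x) <= Mz * dt ^ S p).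
  { intros x Hx. rewrite <- Hw0.
    eapply Rle_trans; [apply (taylor_bound T p wz Mz t1 x)|].
    - apply jet_le with (S (2 * p)); [lia|easy].
    - intros; apply Hzb; [lia|easy].
    - unfold t1 in *; lra.
    - unfold t1 in *; lra.
    - apply Rmult_le_compat_l; [easy|now apply Hpowabs]. }
  assert (HPz' : forall x, tn <= x <= t1 -> Rabs (- a x * z x - P' x) <= Mz * dt ^ p).
  { intros x Hx. replace (- a x * z x) with (wz 1%nat x) by (now rewrite Hw1).
    eapply Rle_trans; [apply (taylor_derive_bound T p wz Mz t1 x)|].
    - apply jet_le with (S (2 * p)); [lia|easy].
    - intros; apply Hzb; [lia|easy].
    - unfold t1 in *; lra.
    - unfold t1 in *; lra.
    - apply Rmult_le_compat_l; [easy|now apply Hpowabs]. }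
  assert (Hzb0 : forall x, tn <= x <= t1 -> Rabs (z x) <= Mz)
    by (intros; rewrite <- Hw0; apply Hzb; [lia|unfold t1 in *; lra]).
  assert (Hab' : forall x, tn <= x <= t1 -> Rabs (a x) <= Ma)
    by (intros; apply Hab; unfold t1 in *; lra).
  assert (HPb : forall x, tn <= x <= t1 -> Rabs (P x) <= 2 * Mz).
  { intros x Hx. replace (P x) with (z x + - (z x - P x)) by ring.
    eapply Rle_trans; [apply Rabs_triang|]. rewrite Rabs_Ropp.
    assert (B1 := Hzb0 x Hx). assert (B2 := HPz x Hx). assert (B3 := Hpow1 (S p)). nra. }
  assert (HPb' : forall x, tn <= x <= t1 -> Rabs (P' x) <= k3).
  { intros x Hx. replace (P' x) with (- a x * z x + - (- a x * z x - P' x)) by ring.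
    eapply Rle_trans; [apply Rabs_triang|]. rewrite (Rabs_Ropp (_ - _)), Rabs_mult, Rabs_Ropp.
    assert (B1 := Hzb0 x Hx). assert (B2 := HPz' x Hx). assert (B3 := Hpow1 p).
    assert (B4 : Rabs (a x) * Rabs (z x) <= Ma * Mz)
      by (apply Rmult_le_compat; try apply Rabs_pos; auto).
    unfold k3. nra. }
  assert (Hdual : forall x, tn <= x <= t1 -> Rabs (P' x + a x * P x) <= k3 * dt ^ p).
  { intros x Hx.
    replace (P' x + a x * P x) with (- (- a x * z x - P' x) + - (a x * (z x - P x))) by ring.
    eapply Rle_trans; [apply Rabs_triang|]. rewrite !Rabs_Ropp, Rabs_mult.
    assert (B1 := HPz' x Hx).
    assert (B4 : Rabs (a x) * Rabs (z x - P x) <= Ma * (Mz * dt ^ S p))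
      by (apply Rmult_le_compat; try apply Rabs_pos; auto).
    assert (B5 := Hpow1 p). simpl (dt ^ S p) in B4. unfold k3.
    assert (0 <= Ma * Mz) by nra. assert (0 <= Ma * Mz * dt ^ p) by nra. nra. }
  set (e := fun m => U m - y (node tn dt m)).
  set (n := fun m => f (node tn dt m) (U m) - f (node tn dt m) (y (node tn dt m))
                     - a (node tn dt m) * e m).
  assert (Hnr : forall m, (m <= p)%nat -> tn <= node tn dt m <= t1)
    by (intros; apply node_range; [lra|easy]).
  set (s := E + del). assert (Hs : 0 <= s) by (unfold s; lra).
  set (d2 := dt ^ (2 * p + 2)). assert (Hd2 := Hpow1 (2 * p + 2)%nat). fold d2 in Hd2.
  assert (Hpp : dt ^ p * dt ^ (p + 2) = d2)
    by (unfold d2; rewrite <- pow_add; f_equal; lia).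
  assert (Hp2 := Hpow1 (p + 2)%nat). assert (Hpp0 := Hpow1 p).
  assert (He : forall m, (m <= p)%nat -> Rabs (e m) <= Cs * (s + dt ^ (p + 2)))
    by (intros m Hm; unfold e, s; eapply Rle_trans; [now apply Hst'|]; lra).
  assert (Hn : forall m, (m <= p)%nat -> Rabs (n m) <= Cn * (2 * Cs + 4 * Cs ^ 2) * (s + d2)).
  { intros m Hm. assert (Hx := Hnr m Hm). assert (Hem := He m Hm).
    assert (Habse : 0 <= Rabs (e m)) by apply Rabs_pos.
    destruct (Hlin (node tn dt m) (U m) ltac:(unfold t1 in *; lra)) as [L1 L2].
    fold (a (node tn dt m)) (e m) in L1, L2. fold (n m) in L1, L2.
    destruct (Rle_lt_dec (dt ^ (p + 2)) s) as [Hc|Hc].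
    - assert (H2s : Rabs (e m) <= 2 * Cs * s) by nra.
      eapply Rle_trans; [exact L1|]. rewrite Rmult_assoc. apply Rmult_le_compat_l; [easy|].
      assert (0 <= Cs ^ 2) by nra.
      assert (0 <= (2 * Cs + 4 * Cs ^ 2) * d2) by nra.
      assert (0 <= Cs ^ 2 * s) by nra. nra.
    - assert (H2s : Rabs (e m) <= 2 * Cs * dt ^ (p + 2)) by nra.
      assert (Hdd : dt ^ (p + 2) <= dt).
      { replace (p + 2)%nat with (S (p + 1)) by lia. simpl.
        assert (H := Hpow1 (p + 1)%nat). nra. }
      assert (Hle1 : Rabs (e m) <= 1) by nra.
      eapply Rle_trans; [now apply L2|]. rewrite Rmult_assoc.
      apply Rmult_le_compat_l; [easy|].
      apply Rle_trans with ((2 * Cs * dt ^ (p + 2)) ^ 2).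
      + apply pow_incr. lra.
      + assert (Hsq : (dt ^ (p + 2)) ^ 2 <= d2).
        { rewrite <- Hpp. simpl (_ ^ 2). rewrite Rmult_1_r. apply Rmult_le_compat_r; [easy|].
          rewrite pow_add. assert (H := Hpow1 2%nat). nra. }
        assert (0 <= Cs ^ 2) by nra.
        rewrite Rpow_mult_distr. replace ((2 * Cs) ^ 2) with (4 * Cs ^ 2) by ring.
        assert (0 <= (2 * Cs + 4 * Cs ^ 2) * s) by nra.
        assert (0 <= Cs * d2) by nra. nra. }
  assert (HPpoly : polyd p P) by apply tay_polyd.
  assert (HPD : forall x, is_derive P x (P' x)) by apply is_derive_tay.
  assert (Hid := dg_test_identity tn dt un U P P' HPpoly HPD). fold t1 in Hid.
  assert (Hqe := Hquad tn dt Hr1). fold t1 in Hqe. fold P P' in Hqe.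
  specialize (Hqe ltac:(intros; apply Hzb; [lia|unfold t1 in *; lra])). fold d2 in Hqe.
  set (qe := dt / 2 * _ - _) in Hqe.
  assert (HP1 : P t1 = z t1) by (unfold P; now rewrite tay_center, Hw0).
  assert (Hyp : y (node tn dt p) = y t1) by (unfold t1; now rewrite node_last).
  set (T1 := sum_f_R0 (fun m => omega m * ((P' (node tn dt m) + a (node tn dt m) * P (node tn dt m))
                * e m)) p).
  set (T2 := sum_f_R0 (fun m => omega m * (P (node tn dt m) * n m)) p).
  set (T4 := sum_f_R0 (fun m => omega m * (P' (node tn dt m) * (U m - dg_map tn dt un U m))) p) in Hid.
  (* Testing with [P] and subtracting the quadrature identity for the exact solution: the linear
     part of [f] joins P' to form the dual residual in [T1], the rest of [f] is [T2]. *)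
  assert (Hmain : z t1 * (U p - y t1) =
    dt / 2 * T1 + dt / 2 * T2 + P tn * (un - y tn)
    - (dt / 2 * T4 - z t1 * (U p - dg_map tn dt un U p)) + qe).
  { rewrite <- HP1, Rmult_minus_distr_l, Hid.
    assert (Hsplit : sum_f_R0 (fun m => omega m * (P' (node tn dt m) * U m)) p
      + sum_f_R0 (fun j => omega j * (P (node tn dt j) * f (node tn dt j) (U j))) p
      = T1 + T2 + sum_f_R0 (fun j => omega j * (P' (node tn dt j) * y (node tn dt j)
             + P (node tn dt j) * f (node tn dt j) (y (node tn dt j)))) p).
    { unfold T1, T2. rewrite <- !sum_plus. apply sum_eq. intros m Hm. unfold n, e. ring. }
    unfold qe.
    replace (sum_f_R0 (fun m => omega m * (P' (node tn dt m) * U m)) p) with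
      (T1 + T2 + sum_f_R0 (fun j => omega j * (P' (node tn dt j) * y (node tn dt j)
             + P (node tn dt j) * f (node tn dt j) (y (node tn dt j)))) p
       - sum_f_R0 (fun j => omega j * (P (node tn dt j) * f (node tn dt j) (U j))) p) by lra.
    ring. }
  assert (B1 : Rabs T1 <= W * (k1 * (s + d2))).
  { apply (sum_weighted_le p omega (fun m => (P' (node tn dt m)
        + a (node tn dt m) * P (node tn dt m)) * e m)).
    intros m Hm. rewrite Rabs_mult.
    apply Rle_trans with (k3 * dt ^ p * (Cs * (s + dt ^ (p + 2)))).
    - apply Rmult_le_compat; try apply Rabs_pos; auto.
    - replace (k3 * dt ^ p * (Cs * (s + dt ^ (p + 2)))) with
        (k1 * (dt ^ p * s + dt ^ p * dt ^ (p + 2))) by (unfold k1, k3; ring).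
      rewrite Hpp. apply Rmult_le_compat_l; [easy|]. nra. }
  assert (B2 : Rabs T2 <= W * (k2 * (s + d2))).
  { apply (sum_weighted_le p omega (fun m => P (node tn dt m) * n m)).
    intros m Hm. rewrite Rabs_mult. unfold k2. rewrite Rmult_assoc.
    apply Rmult_le_compat; try apply Rabs_pos; auto. }
  (* The comparison is with [z t1] and not with the bound [Mz]: after division by [z t1] the old
     error keeps the coefficient 1 + O(dt). *)
  assert (B3 : Rabs (P tn) <= z t1 + 2 * Mz * dt).
  { replace (P tn) with (z t1 + (- (z tn - P tn) + - (z t1 - z tn))) by ring.
    eapply Rle_trans; [apply Rabs_triang|].
    rewrite (Rabs_right (z t1)) by (assert (H := Hzpos t1); lra).
    apply Rplus_le_compat_l. eapply Rle_trans; [apply Rabs_triang|]. rewrite !Rabs_Ropp.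
    assert (C1 := HPz tn ltac:(unfold t1 in *; lra)). simpl (dt ^ S p) in C1.
    assert (C2 : Rabs (z t1 - z tn) <= Mz * Rabs (t1 - tn)).
    { apply (mean_value_bound T z (wz 1%nat)); auto; try (unfold t1 in *; lra).
      - intros x Hx. rewrite Hw1. apply HzD.
      - intros x Hx. apply Hzb; [lia|].
        revert Hx. unfold Rmin, Rmax. destruct (Rle_dec tn t1); unfold t1 in *; lra. }
    replace (t1 - tn) with dt in C2 by (unfold t1; ring).
    rewrite (Rabs_right dt) in C2 by lra.
    assert (dt * dt ^ p <= dt) by nra. nra. }
  assert (B4 : Rabs T4 <= W * (k3 * del)).
  { apply (sum_weighted_le p omega (fun m => P' (node tn dt m) * (U m - dg_map tn dt un U m))).
    intros m Hm. rewrite Rabs_mult.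
    apply Rmult_le_compat; try apply Rabs_pos; auto. }
  assert (Hz1 := Hzpos t1).
  assert (Hz1b : z t1 <= Mz).
  { apply Rle_trans with (Rabs (z t1)); [apply Rle_abs|apply Hzb0; unfold t1 in *; lra]. }
  assert (B5 : Rabs (z t1 * (U p - dg_map tn dt un U p)) <= Mz * del).
  { rewrite Rabs_mult. apply Rmult_le_compat; try apply Rabs_pos; auto.
    rewrite Rabs_right; lra. }
  assert (B6 : Rabs (P tn * (un - y tn)) <= z t1 * E + 2 * Mz * (dt * E)).
  { rewrite Rabs_mult. fold E. nra. }
  assert (Hsc : forall X Y, Rabs X <= Y -> Rabs (dt / 2 * X) <= dt * Y).
  { intros X Y HXY. rewrite Rabs_mult, (Rabs_right (dt / 2)) by lra.
    assert (0 <= Rabs X) by apply Rabs_pos. nra. }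
  assert (Htot : z t1 * Rabs (U p - y t1) <= z t1 * E + Ct * (dt * E + del + d2)).
  { rewrite <- (Rabs_right (z t1)) at 1 by lra. rewrite <- Rabs_mult, Hmain.
    assert (D1 := Hsc _ _ B1). assert (D2 := Hsc _ _ B2). assert (D4 := Hsc _ _ B4).
    set (X1 := dt / 2 * T1) in *. set (X2 := dt / 2 * T2) in *. set (X4 := dt / 2 * T4) in *.
    set (X5 := z t1 * (U p - dg_map tn dt un U p)) in *.
    set (X6 := P tn * (un - y tn)) in *.
    assert (Htri : Rabs (X1 + X2 + X6 - (X4 - X5) + qe)
       <= Rabs X1 + Rabs X2 + Rabs X6 + Rabs X4 + Rabs X5 + Rabs qe).
    { replace (X1 + X2 + X6 - (X4 - X5) + qe) with (X1 + (X2 + (X6 + (- X4 + (X5 + qe))))) by ring.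
      assert (Q1 := Rabs_triang X1 (X2 + (X6 + (- X4 + (X5 + qe))))).
      assert (Q2 := Rabs_triang X2 (X6 + (- X4 + (X5 + qe)))).
      assert (Q3 := Rabs_triang X6 (- X4 + (X5 + qe))).
      assert (Q4 := Rabs_triang (- X4) (X5 + qe)). rewrite Rabs_Ropp in Q4.
      assert (Q5 := Rabs_triang X5 qe). lra. }
    set (g := dt * E + del + d2).
    assert (Hg : dt * (s + d2) <= g) by (unfold g, s; nra).
    assert (HdE : 0 <= dt * E) by nra.
    assert (G1 : dt * (W * (k1 * (s + d2))) <= W * k1 * g).
    { replace (dt * (W * (k1 * (s + d2)))) with (W * k1 * (dt * (s + d2))) by ring.
      now apply Rmult_le_compat_l. }
    assert (G2 : dt * (W * (k2 * (s + d2))) <= W * k2 * g).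
    { replace (dt * (W * (k2 * (s + d2)))) with (W * k2 * (dt * (s + d2))) by ring.
      now apply Rmult_le_compat_l. }
    assert (G4 : dt * (W * (k3 * del)) <= W * k3 * g).
    { replace (dt * (W * (k3 * del))) with (W * k3 * (dt * del)) by ring.
      apply Rmult_le_compat_l; [easy|]. unfold g. nra. }
    assert (G5 : Mz * del <= Mz * g) by (apply Rmult_le_compat_l; [easy|unfold g; lra]).
    assert (G6 : 2 * Mz * (dt * E) <= 2 * Mz * g)
      by (apply Rmult_le_compat_l; [lra|unfold g; lra]).
    assert (G7 : Cq * d2 <= Cq * g) by (apply Rmult_le_compat_l; [easy|unfold g; lra]).
    unfold Ct. lra. }
  assert (Hinv : / z t1 <= Mi).
  { apply Rle_trans with (Rabs (/ z t1)); [apply Rle_abs|apply Hib; unfold t1 in *; lra]. }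
  assert (Hinv0 : 0 < / z t1) by (now apply Rinv_0_lt_compat).
  assert (Hg0 : 0 <= Ct * (dt * E + del + d2)) by (apply Rmult_le_pos; [easy|nra]).
  replace (Rabs (U p - y t1)) with (/ z t1 * (z t1 * Rabs (U p - y t1))) by (field; lra).
  apply Rle_trans with (/ z t1 * (z t1 * E + Ct * (dt * E + del + d2))).
  - apply Rmult_le_compat_l; lra.
  - rewrite Rmult_plus_distr_l, <- Rmult_assoc, Rinv_l, Rmult_1_l by lra.
    apply Rplus_le_compat_l. rewrite Rmult_assoc. now apply Rmult_le_compat_r.
Qed.

(** * The one-step error estimate *)

Lemma endpoint_error :
  exists C h0, 0 <= C /\ 0 < h0 <= 1 /\ forall tn dt un U del, in_range tn dt h0 ->
    (forall m, (m <= p)%nat -> Rabs (U m - dg_map tn dt un U m) <= del) ->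
    Rabs (U p - y (tn + dt))
      <= Rabs (un - y tn) + C * (dt * Rabs (un - y tn) + del + dt ^ (2 * p + 2)).
Proof.
  destruct (Nat.eq_dec p 0) as [Hp0|Hp].
  - destruct stage_error_sharp as (C & h0 & HC & Hh0 & H). exists C, h0.
    split; [easy|]. split; [easy|]. intros tn dt un U del Hr HU.
    assert (Hm := H tn dt un U del Hr HU p (Nat.le_refl p)).
    rewrite node_last in Hm. now replace (2 * p + 2)%nat with (p + 2)%nat by lia.
  - apply superconvergence. lia.
Qed.

Lemma local_error (expl : bool) (K : nat) :
  exists C h0, 0 <= C /\ 0 < h0 <= 1 /\ forall tn dt un unext, in_range tn dt h0 ->
    sdg_step expl p K f tau omega Li tn dt un unext ->
    Rabs (unext - y (tn + dt))
      <= Rabs (un - y tn)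
         + C * (dt * Rabs (un - y tn) + dt ^ S (Nat.min (2 * p + 1) (K + 1))).
Proof.
  destruct euler_initial as (C0 & h1 & HC0 & Hh1 & Heul).
  destruct K as [|K].
  (* Without sweeps the order is 1: the Euler iterate and the exact solution are both compared with
     the reference line. *)
  - destruct slope_bound as (B & HB & Hs).
    exists (C0 + B), h1. split; [lra|]. split; [easy|].
    intros tn dt un unext Hr (U & HU & _ & ->).
    assert (Hr1 : in_range tn dt 1) by (apply in_range_le with h1; [lra|easy]).
    assert (H1 := Heul expl tn dt un (U 0%nat) Hr HU p (Nat.le_refl p)).
    destruct Hr as (Htn & Hdt & HT).
    destruct (Hs tn dt (tn + dt) un Hr1 ltac:(lra)) as (_ & _ & H2).
    rewrite node_last in H1.
    replace (Nat.min (2 * p + 1) (0 + 1)) with 1%nat by lia.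
    set (v0 := f tn (y tn)) in *.
    replace (U 0%nat p - y (tn + dt)) with
      ((un - y tn) + ((U 0%nat p - un - (tn + dt - tn) * v0)
        + - (y (tn + dt) - y tn - (tn + dt - tn) * v0))) by ring.
    eapply Rle_trans; [apply Rabs_triang|]. apply Rplus_le_compat_l.
    eapply Rle_trans; [apply Rabs_triang|]. rewrite Rabs_Ropp.
    set (E := Rabs (un - y tn)) in *. assert (HE : 0 <= E) by apply Rabs_pos.
    assert (0 <= B * (dt * E)) by (apply Rmult_le_pos; nra).
    replace (C0 * (dt * (dt + E))) with (C0 * (dt * E + dt ^ 2)) in H1 by ring. lra.
  - destruct (sweep_defect C0 K HC0) as (Cd & h2 & HCd & Hh2 & Hdef).
    destruct endpoint_error as (Ce & h3 & HCe & Hh3 & Hend).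
    exists (Ce * (2 + Cd)), (Rmin h1 (Rmin h2 h3)).
    assert (L1 := Rmin_l h1 (Rmin h2 h3)). assert (L2 := Rmin_r h1 (Rmin h2 h3)).
    assert (L3 := Rmin_l h2 h3). assert (L4 := Rmin_r h2 h3).
    split; [nra|]. split; [split; [repeat apply Rmin_glb_lt; lra|lra]|].
    intros tn dt un unext Hr (U & HU & Hsw & ->).
    assert (R1 : in_range tn dt h1) by (apply in_range_le with (2 := Hr); lra).
    assert (R2 : in_range tn dt h2) by (apply in_range_le with (2 := Hr); lra).
    assert (R3 : in_range tn dt h3) by (apply in_range_le with (2 := Hr); lra).
    destruct Hr as (Htn & Hdt & HT).
    assert (H1 := Heul expl tn dt un (U 0%nat) R1 HU).
    assert (H2 : sweeps (S K) tn dt un U).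
    { intros k Hk m Hm. apply (sdg_sweep expl); [lra| |easy]. exact (Hsw k Hk). }
    assert (H3 := Hdef tn dt un U R2 H1 H2).
    assert (H4 := Hend tn dt un (U (S K)) _ R3 H3).
    eapply Rle_trans; [exact H4|]. apply Rplus_le_compat_l. rewrite Rmult_assoc.
    apply Rmult_le_compat_l; [easy|].
    set (E := Rabs (un - y tn)) in *. assert (HE : 0 <= E) by apply Rabs_pos.
    (* The number of sweeps is [S K] here, so the defect contributes dt^(K+3), which is exactly the
       exponent (S K + 1) + 1. *)
    set (q := Nat.min (2 * p + 1) (S K + 1)).
    assert (P1 : dt ^ (2 * p + 2) <= dt ^ S q) by (apply pow_antitone; [lra|lia]).
    assert (P2 : dt ^ (K + 3) <= dt ^ S q) by (apply pow_antitone; [lra|lia]).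
    assert (P3 : dt ^ (K + 2) <= dt ^ 1) by (apply pow_antitone; [lra|lia]).
    assert (P4 : 0 <= dt ^ (K + 2)) by (apply pow_le; lra).
    replace (dt ^ (K + 2) * (dt + E)) with (dt ^ (K + 3) + dt ^ (K + 2) * E).
    2: { replace (K + 3)%nat with (S (K + 2)) by lia. simpl. ring. }
    assert (P5 : dt ^ (K + 2) * E <= dt * E) by (simpl in P3; nra).
    assert (P6 : 0 <= dt * E) by nra.
    assert (P7 : 0 <= dt ^ S q) by (apply pow_le; lra).
    assert (Cd * (dt ^ (K + 3) + dt ^ (K + 2) * E) <= Cd * (dt ^ S q + dt * E))
      by (apply Rmult_le_compat_l; lra).
    lra.
Qed.

End LocalError.

(** * Global error *)

Lemma mesh_nonneg t N : 0 <= mesh t N.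
Proof.
  destruct N as [|N]; simpl; [lra|].
  induction N as [|N IH]; simpl; [apply Rmax_l|].
  eapply Rle_trans; [exact IH|apply Rmax_l].
Qed.

Lemma mesh_ge t N n : (n < N)%nat -> t (S n) - t n <= mesh t N.
Proof.
  induction N as [|N IH]; simpl; intros Hn; [lia|].
  destruct (Nat.eq_dec n N) as [->|]; [apply Rmax_r|].
  eapply Rle_trans; [apply IH; lia|apply Rmax_l].
Qed.

Lemma partition_mono T N t i j :
  partition T N t -> (i <= j)%nat -> (j <= N)%nat -> t i <= t j.
Proof.
  intros (_ & _ & Hinc) Hij; induction Hij as [|j Hij IH]; intros Hj; [lra|].
  apply Rle_trans with (t j); [apply IH; lia|]. apply Rlt_le, Hinc; lia.
Qed.

(** The shape of the bound fits the induction: the factor 1 + C d is swallowed by the exponential,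
    while the new contribution C d h extends the linear factor C t, the exponentials being at least
    1. *)
Lemma discrete_gronwall T N t (e : nat -> R) C h :
  partition T N t -> 0 <= C -> 0 <= h -> e 0%nat = 0 -> (forall n, 0 <= e n) ->
  (forall n, (n < N)%nat ->
     e (S n) <= e n + C * ((t (S n) - t n) * e n + (t (S n) - t n) * h)) ->
  forall n, (n <= N)%nat -> e n <= exp (C * t n) * (C * t n) * h.
Proof.
  intros HP HC Hh He0 Hepos Hstep. induction n as [|n IH]; intros Hn.
  - replace (t 0%nat) with 0 by (symmetry; apply HP). rewrite He0. lra.
  - specialize (IH ltac:(lia)). specialize (Hstep n ltac:(lia)).
    assert (H0 : 0 <= t n).
    { replace 0 with (t 0%nat) by apply HP. apply (partition_mono T N); [easy|lia|lia]. }
    assert (Hd : t n < t (S n)) by (apply HP; lia).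
    set (d := t (S n) - t n) in *. assert (Hd0 : 0 < d) by (unfold d; lra).
    replace (t (S n)) with (t n + d) by (unfold d; ring).
    rewrite Rmult_plus_distr_l, exp_plus.
    assert (HCd : 0 <= C * d) by nra. assert (HCt : 0 <= C * t n) by nra.
    assert (E1 : 1 + C * d <= exp (C * d)).
    { destruct (Req_dec (C * d) 0) as [->|Hne]; [rewrite exp_0; lra|].
      apply Rlt_le, exp_ineq1; lra. }
    assert (E2 : 1 <= exp (C * t n)).
    { destruct (Req_dec (C * t n) 0) as [->|Hne]; [rewrite exp_0; lra|].
      assert (H := exp_ineq1 (C * t n) Hne). lra. }
    set (a := exp (C * t n)) in *. set (b := exp (C * d)) in *.
    apply Rle_trans with ((1 + C * d) * (a * (C * t n) * h) + C * d * h).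
    + assert ((1 + C * d) * e n <= (1 + C * d) * (a * (C * t n) * h))
        by (apply Rmult_le_compat_l; lra). lra.
    + assert (Hq : 0 <= a * (C * t n) * h) by (apply Rmult_le_pos; [nra|easy]).
      assert (Hr : 0 <= C * d * h) by nra.
      assert (F1 : (1 + C * d) * (a * (C * t n) * h) <= b * (a * (C * t n) * h))
        by (now apply Rmult_le_compat_r).
      assert (F2 : 1 * (C * d * h) <= a * b * (C * d * h))
        by (apply Rmult_le_compat_r; [easy|nra]).
      lra.
Qed.

(** * Extension of the exact solution to the whole line *)

Lemma clamp_range T x : 0 <= T -> 0 <= Rmax 0 (Rmin x T) <= T.
Proof.
  intros HT. unfold Rmax, Rmin. destruct (Rle_dec x T); destruct (Rle_dec 0 _); lra.
Qed.

Lemma clamp_id T x : 0 <= x <= T -> Rmax 0 (Rmin x T) = x.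
Proof.
  intros HT. unfold Rmax, Rmin. destruct (Rle_dec x T); destruct (Rle_dec 0 _); lra.
Qed.

Lemma clamp_lip T x x' :
  0 <= T -> Rabs (Rmax 0 (Rmin x T) - Rmax 0 (Rmin x' T)) <= Rabs (x - x').
Proof.
  intros HT. unfold Rmax, Rmin, Rabs.
  destruct (Rle_dec x T); destruct (Rle_dec x' T);
    repeat destruct (Rle_dec 0 _); repeat destruct (Rcase_abs _); lra.
Qed.

Lemma clamp_continuous u T x :
  0 <= T -> cont_on u 0 T -> continuous (fun s => u (Rmax 0 (Rmin s T))) x.
Proof.
  intros HT Hu. apply continuity_pt_filterlim. intros eps Heps.
  destruct (Hu (Rmax 0 (Rmin x T)) (clamp_range T x HT) eps Heps) as (d & Hd & Hud).
  exists d; split; [easy|]. intros s [_ Hs]. simpl in *. unfold Rdist in *.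
  apply Hud; [now apply clamp_range|].
  eapply Rle_lt_trans; [now apply clamp_lip|easy].
Qed.

Lemma clamp_derive u T x l :
  0 < x < T -> derivable_pt_lim u x l ->
  is_derive (fun s => u (Rmax 0 (Rmin s T))) x l.
Proof.
  intros Hx Hu. apply is_derive_ext_loc with u; [|now apply is_derive_Reals].
  assert (Hd : 0 < Rmin x (T - x)) by (apply Rmin_glb_lt; lra).
  exists (mkposreal _ Hd). intros s Hs. f_equal. symmetry. apply clamp_id.
  assert (Hs' : Rabs (s - x) < Rmin x (T - x)) by exact Hs.
  assert (B1 := Rmin_l x (T - x)). assert (B2 := Rmin_r x (T - x)).
  apply Rabs_lt_between in Hs'. lra.
Qed.

Theorem theorem1 (p K : nat) (expl : bool) (T u0 : R)
  (f : R -> R -> R) (u : R -> R)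
  (tau omega : nat -> R) (Lm Li : nat -> nat -> R) :
  Ck (2 * p + 1) f ->
  lipschitz_u f ->
  (* u is the exact solution on [0,T] *)
  u 0 = u0 ->
  cont_on u 0 T ->
  (forall t, 0 < t < T -> derivable_pt_lim u t (f t (u t))) ->
  right_radau p tau omega ->
  is_Lmat p tau Lm ->
  is_inverse p Lm Li ->
  exists C h0 : R, C >= 0 /\ h0 > 0 /\
    forall (N : nat) (t : nat -> R) (un : nat -> R),
      partition T N t ->
      mesh t N <= h0 ->
      sdg_solution expl p K f tau omega Li u0 N t un ->
      forall n, (n <= N)%nat ->
        Rabs (u (t n) - un n) <= C * mesh t N ^ (Nat.min (2 * p + 1) (K + 1)).
Proof.
  intros Hf [Lc HLc] Hu0 Huc HuD HR HL HI.
  set (q := Nat.min (2 * p + 1) (K + 1)).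
  (* For negative [T] no partition exists, so any constants serve. *)
  destruct (Rlt_le_dec T 0) as [HT|HT].
  { exists 0, 1. split; [lra|]. split; [lra|]. intros N t un HP _ _ n Hn.
    assert (H := partition_mono T N t 0 N HP ltac:(lia) ltac:(lia)).
    destruct HP as (H0 & HN & _). lra. }
  (* [u] is controlled only on [0, T]. Composing it with the projection onto that interval yields a
     function continuous everywhere that still solves the equation inside. *)
  set (y := fun s => u (Rmax 0 (Rmin s T))).
  assert (Hy : forall s, 0 <= s <= T -> y s = u s)
    by (intros s Hs; unfold y; now rewrite clamp_id).
  assert (Hyc : forall x, continuous y x) by (intros; now apply clamp_continuous).
  assert (HyD : forall s, 0 < s < T -> is_derive y s (f s (y s))).
  { intros s Hs. rewrite Hy by lra. apply clamp_derive; [easy|now apply HuD]. }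
  assert (HLip : forall t x x', Rabs (f t x - f t x') <= Rabs Lc * Rabs (x - x')).
  { intros t x x'. eapply Rle_trans; [apply HLc|].
    apply Rmult_le_compat_r; [apply Rabs_pos|apply Rle_abs]. }
  destruct (local_error p tau omega Lm Li T (Rabs Lc) f y HR HL HI (Rabs_pos Lc) HLip
              Hf Hyc HyD expl K) as (C & h0 & HC & Hh0 & Hloc).
  assert (Hexp := exp_pos (C * T)).
  exists (exp (C * T) * (C * T)), h0.
  split; [apply Rle_ge; apply Rmult_le_pos; nra|]. split; [lra|].
  intros N t un HP Hmesh (Hun0 & Hsol) n Hn.
  set (h := mesh t N) in *. assert (Hh : 0 <= h) by apply mesh_nonneg.
  assert (Htr : forall i, (i <= N)%nat -> 0 <= t i <= T).
  { intros i Hi. destruct HP as (H0 & HN & Hinc). rewrite <- H0 at 1. rewrite <- HN.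
    split; apply (partition_mono T N); auto; try lia; now repeat split. }
  assert (Hg := discrete_gronwall T N t (fun i => Rabs (un i - y (t i))) C (h ^ q) HP HC
                  (pow_le _ _ Hh)).
  cbv beta in Hg.
  assert (Hfin : Rabs (un n - y (t n)) <= exp (C * t n) * (C * t n) * h ^ q).
  { apply Hg; [| intros; apply Rabs_pos | | easy].
    - destruct HP as (H0 & _). rewrite H0, Hy, Hun0, Hu0 by lra.
      replace (u0 - u0) with 0 by ring. apply Rabs_R0.
    - intros i Hi. assert (Hm := mesh_ge t N i Hi). fold h in Hm.
      assert (Hti := Htr i ltac:(lia)). assert (HtS := Htr (S i) ltac:(lia)).
      assert (Hinc : t i < t (S i)) by (apply HP; lia).
      assert (Hl := Hloc (t i) (t (S i) - t i) (un i) (un (S i))).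
      replace (t i + (t (S i) - t i)) with (t (S i)) in Hl by ring.
      eapply Rle_trans; [apply Hl; [unfold in_range; lra|now apply Hsol]|].
      apply Rplus_le_compat_l. apply Rmult_le_compat_l; [easy|].
      (* One factor of the local power stays with its step and is summed by Gronwall; the remaining
         q factors are bounded by the mesh. *)
      apply Rplus_le_compat_l. simpl (_ ^ S _). apply Rmult_le_compat_l; [lra|].
      apply pow_incr. lra. }
  assert (Htn := Htr n Hn). rewrite Hy in Hfin by easy.
  rewrite Rabs_minus_sym. eapply Rle_trans; [exact Hfin|].
  apply Rmult_le_compat_r; [now apply pow_le|].
  assert (HCt : C * t n <= C * T) by nra.
  apply Rmult_le_compat; [apply Rlt_le, exp_pos|nra| |easy].
  destruct HCt as [HCt|HCt]; [apply Rlt_le; now apply exp_increasing|rewrite HCt; lra].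
Qed.
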